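(* Let $k\in\mathbb N$ and let $\mu$ be a Borel probability measure on $[0,1]^k$ satisfying \[ \dim_{\ell^1}(\mu)>k-\frac{k}{k+1}. \] Then $\mu$ is inhomogeneous convergent Khinchin. If moreover $\mu=\mu_1\times\cdots\times\mu_k$ is a product of Borel probability measures on $[0,1]$ with \[ \dim_{\ell^1}(\mu_j)>1-\frac{1}{k+1}\qquad(1\leqslant j\leqslant k), \] then $\mu$ is inhomogeneous convergent Gallagher.
   Context: $\|x\|$ is the distance from $x\in\mathbb R$ to the nearest integer, $e(x)=e^{2\pi i x}$. For a Borel probability measure $\nu$ on $[0,1]^k$, $\hat\nu({\boldsymbol{\xi}})=\int e(-{\boldsymbol{\xi}}\cdot\mathbf x)\,d\nu(\mathbf x)$ for ${\boldsymbol{\xi}}\in\mathbb Z^k$, and $\dim_{\ell^1}(\nu)=\sup\{s\geqslant0:\sum_{\|{\boldsymbol{\xi}}\|_\infty\leqslant Q}|\hat\nu({\boldsymbol{\xi}})|\ll Q^{k-s}\ (Q\geqslant1)\}$ (with $k=1$ for measures on $[0,1]$). For $\psi:\mathbb N\to[0,1)$ and $\mathbf y\in\mathbb R^k$: $W_k(\psi,\mathbf y)$ is the set of $\mathbf x\in[0,1)^k$ with $\max_j\|nx_j-y_j\|<\psi(n)$ for infinitely many $n\in\mathbb N$; $W_k^\times(\psi,\mathbf y)$ is the set of $\mathbf x\in[0,1)^k$ with $\prod_{j=1}^k\|nx_j-y_j\|<\psi(n)$ for infinitely many $n\in\mathbb N$. A probability measure $\mu$ on $[0,1]^k$ is inhomogeneous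 convergent Khinchin if for every non-increasing $\psi:\mathbb N\to[0,1)$ with $\sum_n\psi(n)^k<\infty$ we have $\mu(W_k(\psi,\mathbf y))=0$ for all $\mathbf y\in\mathbb R^k$; it is inhomogeneous convergent Gallagher if for every non-increasing $\psi:\mathbb N\to[0,1)$ with $\sum_n\psi(n)(\log n)^{k-1}<\infty$ we have $\mu(W^\times_k(\psi,\mathbf y))=0$ for all $\mathbf y\in\mathbb R^k$. *)

(* Defs.v *)
(* R : realType; the space R^k is k.-tuple R
   with its product sigma-algebra of Borel sets (= Borel sigma-algebra of R^k). *)
From HB Require Import structures.
From mathcomp Require Import all_boot all_order all_algebra.
From mathcomp Require Import all_classical all_reals all_analysis.
Unset Printing Implicit Defensive.
Import Order.TTheory GRing.Theory Num.Theory.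
Local Open Scope classical_set_scope.
Local Open Scope ring_scope.

Section Defs.
Variable R : realType.

Definition distZ (x : R) : R :=
  Num.min (x - (Num.floor x)%:~R) ((Num.ceil x)%:~R - x).

Definition cube01 (k : nat) : set (k.-tuple R) :=
  [set x | forall j : 'I_k, 0 <= tnth x j <= 1].
Definition cube01ho (k : nat) : set (k.-tuple R) :=
  [set x | forall j : 'I_k, 0 <= tnth x j < 1].

Definition dotZ (k : nat) (xi : 'I_k -> int) (x : k.-tuple R) : R :=
  \sum_(j < k) (xi j)%:~R * tnth x j.

(* |nu^(xi)| where nu^(xi) = \int e(-xi.x) dnu(x) over [0,1]^k,
   written through real and imaginary parts:
   nu^(xi) = \int cos(2 pi xi.x) dnu - i \int sin(2 pi xi.x) dnu. *)
Definition fourier_abs (k : nat) (nu : probability (k.-tuple R) R)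
    (xi : 'I_k -> int) : R :=
  Num.sqrt ((Rintegral nu (cube01 k) (fun x => cos (2 * pi * dotZ k xi x))) ^+ 2
          + (Rintegral nu (cube01 k) (fun x => sin (2 * pi * dotZ k xi x))) ^+ 2).

Definition fourier_abs1 (nu : probability R R) (xi : int) : R :=
  Num.sqrt ((Rintegral nu [set` `[0%R, 1%R]] (fun x => cos (2 * pi * (xi%:~R * x)))) ^+ 2
          + (Rintegral nu [set` `[0%R, 1%R]] (fun x => sin (2 * pi * (xi%:~R * x)))) ^+ 2).

(* \sum_{xi in Z^k, ||xi||_oo <= N} F xi ; the box {-N..N}^k is enumerated by
   b : {ffun 'I_k -> 'I_(2N+1)}, xi_j = b_j - N. *)
Definition box_sum (k N : nat) (F : ('I_k -> int) -> R) : R :=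
  \sum_(b : {ffun 'I_k -> 'I_(N.*2.+1)}) F (fun j => (b j)%:Z - N%:Z).

(* ell^1 dimension of a family of Fourier coefficient moduli F on Z^k:
   sup { s >= 0 : sum_{||xi||_oo <= Q} F xi << Q^(k-s)  (Q >= 1) }
   (Q real; ||xi||_oo <= Q iff ||xi||_oo <= floor Q). *)
Definition l1dim_of (k : nat) (F : ('I_k -> int) -> R) : \bar R :=
  ereal_sup [set (s%:E)%E | s in
    [set s : R | 0 <= s /\
      exists C : R, forall Q : R, 1 <= Q ->
        box_sum k `|Num.floor Q|%N F <= C * powR Q (k%:R - s)]].

Definition dim_l1 (k : nat) (nu : probability (k.-tuple R) R) : \bar R :=
  l1dim_of k (fourier_abs k nu).

Definition dim_l1_1 (nu : probability R R) : \bar R :=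
  l1dim_of 1 (fun xi => fourier_abs1 nu (xi ord0)).

Definition W_set (k : nat) (psi : nat -> R) (y : k.-tuple R) : set (k.-tuple R) :=
  [set x | cube01ho k x /\
    infinite_set [set n : nat | (0 < n)%N /\
      \big[Num.max/0]_(j < k) distZ (n%:R * tnth x j - tnth y j) < psi n]].

Definition Wmult_set (k : nat) (psi : nat -> R) (y : k.-tuple R) : set (k.-tuple R) :=
  [set x | cube01ho k x /\
    infinite_set [set n : nat | (0 < n)%N /\
      \prod_(j < k) distZ (n%:R * tnth x j - tnth y j) < psi n]].

(* psi : N -> [0,1) non-increasing, N = {1,2,...} (values at 0 irrelevant) *)
Definition admissible (psi : nat -> R) : Prop :=
  (forall n, (0 < n)%N -> 0 <= psi n < 1) /\
  (forall m n, (0 < m)%N -> (m <= n)%N -> psi n <= psi m).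

Definition inhom_conv_Khinchin (k : nat) (mu : probability (k.-tuple R) R) : Prop :=
  forall psi : nat -> R, admissible psi ->
    (\sum_(1 <= n <oo) ((psi n) ^+ k)%:E < +oo)%E ->
    forall y : k.-tuple R, mu (W_set k psi y) = 0%E.

Definition inhom_conv_Gallagher (k : nat) (mu : probability (k.-tuple R) R) : Prop :=
  forall psi : nat -> R, admissible psi ->
    (\sum_(1 <= n <oo) (psi n * (ln (n%:R : R)) ^+ k.-1)%:E < +oo)%E ->
    forall y : k.-tuple R, mu (Wmult_set k psi y) = 0%E.

(* mu = mu_1 x ... x mu_k : mu agrees with the product on measurable boxes
   (this determines the product measure uniquely). *)
Definition is_product_measure (k : nat) (mu : probability (k.-tuple R) R)
    (mus : 'I_k -> probability R R) : Prop :=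
  forall A : 'I_k -> set R, (forall j, measurable (A j)) ->
    mu [set x | forall j, A j (tnth x j)] = (\prod_(j < k) mus j (A j))%E.

End Defs.

(* Main.v *)
Require Import Defs.
From HB Require Import structures.
From mathcomp Require Import all_boot all_order all_algebra.
From mathcomp Require Import all_classical all_reals all_analysis.
From mathcomp Require Import measurable_realfun zify ring lra.
Import Order.TTheory GRing.Theory Num.Theory.
Local Open Scope classical_set_scope.
Local Open Scope ring_scope.

(** Split the integers n into dyadic blocks [N, 2N), N = 2^m, and apply the
    first Borel-Cantelli lemma to the blocks.  The Fejer kernel of length M of
    order 1/delta bounds the measure of {x : ||n x_j - y_j|| < delta for all j} by
    O(delta^k) * \sum_{|h| < M} |mu^(n h)|.  The term h = 0 gives the expected
    O(delta^k).  For h <> 0, summing over n in the block and grouping by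
    xi = n h costs only a divisor bound (N M)^eps, so the l^1 hypothesis gives
    O((N M)^a) with a < k/(k+1); replacing psi(N) by
    max(psi(N), N^(-(1+eta)/k)) this is O(N), and Cauchy condensation concludes.

    In the multiplicative case, {z in [0,1)^k : \prod z_j < delta} is covered by
    O(log(1/delta)^(k-1)) dyadic boxes \prod [0, 2^(-e_j)) of volume O(delta).
    The measure of a box factorises into 1 + S_j(n), where S_j is the sum over
    h <> 0 in one dimension, and
    \sum_n \prod_j (1 + S_j(n)) <= N + \prod_j (1 + \sum_n S_j(n)),
    whose last term is O((N^k / delta)^a) = O(N) since a < 1/(k+1). *)

(** * Growth estimates and the divisor bound d(n) = O(n^eps) *)

Lemma bernoulli_ge (R : realType) (r : R) (m : nat) :
  1 <= r -> 1 + (r - 1) * m%:R <= r ^+ m.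
Proof.
move=> r1; elim: m => [|m IH]; first by rewrite mulr0 addr0 expr0.
have H0 : (0 : R) <= m%:R by [].
rewrite exprS -natr1; apply: le_trans (_ : r * (1 + (r - 1) * m%:R) <= _).
  have := mulr_ge0 (sqr_ge0 (r - 1)) H0; rewrite expr2; lra.
by rewrite ler_pM2l //; lra.
Qed.

(** Induction on j with r replaced by its square root q: one factor m + 1 is absorbed by q^m through
    Bernoulli's inequality, the other j factors by the second q^m. *)
Lemma poly_le_geometric (R : realType) (j : nat) (r : R) : 1 < r ->
  exists2 C : R, 1 <= C & forall m, (m.+1%:R) ^+ j <= C * r ^+ m.
Proof.
elim: j r => [|j IH] r r1.
  by exists 1 => // m; rewrite expr0 mul1r exprn_ege1 // ltW.
have r0 : 0 < r by lra.
pose q := Num.sqrt r.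
have q1 : 1 < q by rewrite -sqrtr1 ltr_sqrt.
have [C C1 HC] := IH q q1.
have i0 : 0 < (q - 1)^-1 by rewrite invr_gt0; lra.
have D1 : 1 <= 1 + (q - 1)^-1 by lra.
exists ((1 + (q - 1)^-1) * C) => [|m]; first by rewrite (le_trans C1)// ler_peMl//; lra.
have -> : r ^+ m = q ^+ m * q ^+ m.
  by rewrite -exprMn -expr2 sqr_sqrtr // ltW.
rewrite exprS mulrACA; apply: ler_pM => //.
have B := bernoulli_ge R q m (ltW q1).
have m0 : (0 : R) <= m%:R by [].
rewrite -natr1 mulrDl mul1r.
have : (q - 1)^-1 * (1 + (q - 1) * m%:R) <= (q - 1)^-1 * q ^+ m by rewrite ler_pM2l.
have -> : (q - 1)^-1 * (1 + (q - 1) * m%:R) = (q - 1)^-1 + m%:R.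
  by field; lra.
have := mulr_ge0 (_ : 0 <= q - 1) m0; lra.
Qed.

(** Every divisor of p^a m has the form p^i d with i <= a and d dividing m; for an upper bound it
    suffices to list these products. *)
Lemma size_divisors_pfactor (p a m : nat) : prime p -> (0 < m)%N ->
  coprime p m -> (size (divisors (p ^ a * m)) <= a.+1 * size (divisors m))%N.
Proof.
move=> pp m0 cpm.
have n0 : (0 < p ^ a * m)%N by rewrite muln_gt0 expn_gt0 prime_gt0.
pose s := [seq (p ^ i * d)%N | i <- iota 0 a.+1, d <- divisors m].
have -> : (a.+1 * size (divisors m) = size s)%N by rewrite size_allpairs size_iota.
apply: uniq_leq_size; first exact: divisors_uniq.
move=> d; rewrite -dvdn_divisors // => dn.
have d0 : (0 < d)%N := dvdn_gt0 n0 dn.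
have [d' cpd' def_d] := pfactor_coprime pp d0.
apply/allpairsP; exists (logn p d, d'); split; last by rewrite /= mulnC.
- rewrite mem_iota /= add0n ltnS.
  have := dvdn_leq_log p n0 dn.
  rewrite lognM ?expn_gt0 ?(prime_gt0 pp) // pfactorK //.
  suff -> : logn p m = 0 by rewrite addn0.
  by rewrite logn_coprime.
- rewrite -dvdn_divisors //.
  have : (d' %| p ^ a * m)%N by apply: dvdn_trans dn; rewrite def_d dvdn_mulr.
  by rewrite Gauss_dvdr // coprime_sym coprimeXl.
Qed.

(** Large primes cost no constant: each prime power p^a exactly dividing n contributes a + 1 <= 2^a
    <= p^(a eps). *)
Lemma divisor_bound_rough (R : realType) (eps : R) (P : nat) : 0 < eps ->
  2 <= (P%:R : R) `^ eps ->
  forall n, (0 < n)%N -> (forall p, prime p -> (p %| n)%N -> (P <= p)%N) ->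
  (size (divisors n))%:R <= (n%:R : R) `^ eps.
Proof.
move=> e0 P2 n; elim/ltn_ind: n => n IH n0 Hp.
have [n1|n1] := leqP n 1.
  have -> : n = 1%N by lia.
  by rewrite powR1.
have pp := pdiv_prime n1; set p := pdiv n in pp.
have pn : (p %| n)%N := pdiv_dvd n.
have [m cpm def_n] := pfactor_coprime pp n0.
have m0 : (0 < m)%N by rewrite lt0n; apply: contraL n0 => /eqP m0; rewrite def_n m0.
set a := logn p n in def_n.
have a0 : (0 < a)%N by rewrite logn_gt0 mem_primes pp n0.
have mn : (m < n)%N.
  by rewrite def_n ltn_Pmulr // -(exp1n a) ltn_exp2r ?prime_gt1.
have Hm : (size (divisors m))%:R <= (m%:R : R) `^ eps.
  apply: IH => // q qq qm; apply: Hp => //.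
  by rewrite def_n dvdn_mulr.
rewrite def_n mulnC.
apply: (@le_trans _ _ ((a.+1 * size (divisors m))%:R)).
  by rewrite ler_nat size_divisors_pfactor.
rewrite natrM natrM powRM ?ler0n //; apply: ler_pM; rewrite ?ler0n // natrX.
have p2 : 2 <= (p%:R : R) `^ eps.
  apply: (le_trans P2); apply: ge0_ler_powR; rewrite ?nnegrE ?ler0n ?(ltW e0) //.
  by rewrite ler_nat Hp.
have -> : (p%:R ^+ a : R) `^ eps = (p%:R `^ eps) ^+ a.
  by rewrite -powR_mulrn ?ler0n // powRAC powR_mulrn ?powR_ge0.
apply: (@le_trans _ _ (2 ^+ a)); last first.
  by apply: lerXn2r; rewrite ?nnegrE //; lra.
by rewrite -natrX ler_nat ltn_expl.
Qed.

(** Only the primes q below P, roughly 2^(1/eps), can violate a + 1 <= q^(a eps). There are finitely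
    many, and each multiplies the constant by some K with a + 1 <= K q^(a eps). *)
Lemma divisor_bound (R : realType) (eps : R) : 0 < eps ->
  exists2 C : R, 1 <= C & forall n, (0 < n)%N ->
  (size (divisors n))%:R <= C * (n%:R : R) `^ eps.
Proof.
move=> e0.
pose P := (Num.truncn ((2 : R) `^ eps^-1)).+1.
have P2 : 2 <= (P%:R : R) `^ eps.
  have -> : (2 : R) = (2 `^ eps^-1) `^ eps.
    by rewrite -powRrM mulVf ?gt_eqF // powRr1.
  apply: ge0_ler_powR; rewrite ?nnegrE ?ler0n ?powR_ge0 ?(ltW e0) //.
  exact/ltW/truncnS_gt.
suff H i : (i <= P)%N -> exists2 C : R, 1 <= C & forall n, (0 < n)%N ->
    (forall p, prime p -> (p %| n)%N -> (P - i <= p)%N) ->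
    (size (divisors n))%:R <= C * (n%:R : R) `^ eps.
  have [C C1 HC] := H P (leqnn P).
  by exists C => // n n0; apply: HC => // p _ _; rewrite subnn.
elim: i => [|i IH] iP.
  exists 1 => // n n0 Hp; rewrite mul1r.
  by apply: (divisor_bound_rough R eps P) => // p; rewrite -(subn0 P); exact: Hp.
have [C C1 HC] := IH (ltnW iP).
set q := (P - i.+1)%N in HC *.
have qE : (P - i = q.+1)%N by rewrite /q; lia.
rewrite qE in HC.
have [pq|pq] := boolP (prime q); last first.
  exists C => // n n0 Hp; apply: HC => // p pp pn.
  rewrite ltn_neqAle Hp // andbT; apply: contra pq => /eqP -> //.
have q1 : 1 < (q%:R : R) `^ eps.
  have E : (1 : R) `^ eps = 1 by rewrite powR1.
  rewrite -[ltLHS]E; apply: gt0_ltr_powR; rewrite ?nnegrE ?ler0n //.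
  by rewrite ltr1n prime_gt1.
have [K K1 HK] := poly_le_geometric R 1 _ q1.
exists (K * C) => [|n n0 Hp].
  by rewrite (le_trans C1)// ler_peMl//; lra.
have [m cpm def_n] := pfactor_coprime pq n0.
have m0 : (0 < m)%N by rewrite lt0n; apply: contraL n0 => /eqP m0; rewrite def_n m0.
set a := logn q n in def_n.
have Hm : (size (divisors m))%:R <= C * (m%:R : R) `^ eps.
  apply: HC => // p pp pm.
  rewrite ltn_neqAle Hp // ?andbT; last by rewrite def_n dvdn_mulr.
  apply/eqP => qp; move: cpm; rewrite qp prime_coprime //.
  by rewrite pm.
rewrite def_n mulnC.
apply: (@le_trans _ _ ((a.+1 * size (divisors m))%:R)).
  by rewrite ler_nat size_divisors_pfactor.
rewrite natrM natrM powRM ?ler0n // mulrACA; apply: ler_pM; rewrite ?ler0n // natrX.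
have -> : (q%:R ^+ a : R) `^ eps = (q%:R `^ eps) ^+ a.
  by rewrite -powR_mulrn ?ler0n // powRAC powR_mulrn ?powR_ge0.
by rewrite -[leLHS]expr1.
Qed.

(** * Fourier coefficients summed over dilated boxes *)

Section DilatedBoxSum.
Context {R : realType} {k : nat}.
Implicit Types F : ('I_k -> int) -> R.

(** The error term of the Fejer bound: the frequencies n h without h = 0. The radius [M.-1] is the
    largest difference of two elements of {0, ..., M - 1}. *)
Definition dilated_rest F (n M : nat) : R :=
  box_sum R k M.-1 (fun h => F (fun j => n%:Z * h j)) - F (fun=> 0).

Lemma dilated_restE F n M : dilated_rest F n M =
  \sum_(b : {ffun 'I_k -> 'I_(M.-1.*2.+1)} | b != [ffun=> inord M.-1])
     F (fun j => n%:Z * ((b j)%:Z - (M.-1)%:Z)).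
Proof.
rewrite /dilated_rest /box_sum (bigD1 [ffun=> inord M.-1]) //=.
rewrite addrAC [X in X - _](_ : _ = F (fun=> 0)) ?subrr ?add0r //.
congr F; apply/funext => j; rewrite ffunE inordK; last by lia.
by rewrite subrr mulr0.
Qed.

Lemma dilated_rest_ge0 F n M : (forall xi, 0 <= F xi) -> 0 <= dilated_rest F n M.
Proof. by move=> F0; rewrite dilated_restE sumr_ge0. Qed.

(* A nonzero xi in the big box is n * h for at most as many pairs (n, h) as a
   nonzero coordinate of xi has divisors. *)
Lemma sum_dilated_rest_le F (D : R) (N M : nat) :
  (forall xi, 0 <= F xi) -> (0 < N)%N -> (0 < M)%N ->
  (forall n, (0 < n <= (N * M).*2)%N -> (size (divisors n))%:R <= D) ->
  \sum_(i < N) dilated_rest F (N + i) M <= D * box_sum R k (N * M).*2 F.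
Proof.
move=> F0 N0 M0 HD; set Q := (N * M).*2.
under eq_bigr do rewrite dilated_restE.
rewrite pair_big_dep /=.
(* [g] sends (i, h) to the index of xi = (N + i) h in the box of radius Q = 2 N M, which is large
   enough because N + i < 2 N. *)
pose g (p : 'I_N * {ffun 'I_k -> 'I_(M.-1.*2.+1)}) : {ffun 'I_k -> 'I_(Q.*2.+1)} :=
  [ffun j => inord (absz ((N + p.1)%:Z * ((p.2 j)%:Z - (M.-1)%:Z) + Q%:Z))].
have gE p j : (g p j)%:Z - Q%:Z = (N + p.1)%:Z * ((p.2 j)%:Z - (M.-1)%:Z).
  have b1 : (absz ((p.2 j)%:Z - (M.-1)%:Z)%R <= M.-1)%N by have := ltn_ord (p.2 j); lia.
  have b2 : (absz ((N + p.1)%:Z * ((p.2 j)%:Z - (M.-1)%:Z))%R <= Q)%N.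
    rewrite abszM absz_nat.
    apply: (@leq_trans (N.*2 * M)%N); last by rewrite /Q -doubleMl.
    apply: leq_mul; last by lia.
    by have := ltn_ord p.1; lia.
  rewrite /g ffunE inordK; last by lia.
  lia.
rewrite (partition_big g predT) //= /box_sum mulr_sumr; apply: ler_sum => c _.
set xi := (fun j => (c j)%:Z - Q%:Z).
rewrite (eq_bigr (fun=> F xi)); last first.
  move=> p /andP[_ /eqP gp]; congr F; apply/funext => j.
  by rewrite /xi -gp gE.
rewrite sumr_const -mulr_natl; apply: ler_wpM2r => //.
pose A := [pred p | (p.2 != [ffun=> inord M.-1]) && (g p == c)].
rewrite (_ : #|_| = #|A|); last exact: eq_card.
have [A0|/card_gt0P[p0 Ap0]] := posnP #|A|.
  (* On an empty fibre only D >= 0 is at stake; it follows from the bound at n = 1. *)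
  rewrite A0 (le_trans _ (HD 1%N _)) //; apply/andP; split => //; rewrite /Q; nia.
have /andP[p0c /eqP gp0] := Ap0.
have [j0 hj0] : exists j0, (p0.2 j0)%:Z - (M.-1)%:Z != 0.
  apply/existsP; apply: contraR p0c; rewrite negb_exists => /forallP H.
  apply/eqP/ffunP => j; rewrite ffunE; apply/val_inj.
  rewrite /= inordK; last by lia.
  by have := H j; rewrite negbK subr_eq0 => /eqP [->].
have xi0 : xi j0 != 0.
  rewrite /xi -gp0 gE mulf_neq0 //; lia.
have s0 : (0 < `|xi j0| <= Q)%N.
  by rewrite absz_gt0 xi0 /= /xi; have := ltn_ord (c j0); lia.
apply: le_trans (HD _ s0); rewrite ler_nat.
(* On a fibre, n = N + i determines h = xi / n, so the fibre injects into the divisors of the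
   nonzero coordinate [xi j0]. *)
rewrite cardE -(size_map (fun p : 'I_N * {ffun 'I_k -> 'I_(M.-1.*2.+1)} => (N + p.1)%N)).
apply: uniq_leq_size.
  rewrite map_inj_in_uniq ?enum_uniq //.
  move=> p q; rewrite !mem_enum => /andP[_ /eqP gp] /andP[_ /eqP gq] pq.
  have pq1 : p.1 = q.1 by apply/val_inj => /=; lia.
  rewrite [p]surjective_pairing [q]surjective_pairing pq1; congr pair.
  apply/ffunP => j; apply/val_inj => /=.
  have := gE p j; rewrite gp -gq gE pq1.
  have n0 : (N + q.1)%:Z != 0 by lia.
  move/(mulfI n0); lia.
move=> d /mapP[p]; rewrite mem_enum => /andP[_ /eqP gp] ->.
rewrite -dvdn_divisors; last by case/andP: s0.
by rewrite /xi -gp gE abszM absz_nat dvdn_mulr.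
Qed.

End DilatedBoxSum.

(** Some s > k - beta is admissible in the supremum; the box sum of radius 2 N M is then O((N M)^(k
    - s)), and the divisor bound fits into the gap between k - s and beta. *)
Lemma l1dim_dilated_rest (R : realType) (k : nat) (F : ('I_k -> int) -> R) (beta : R) :
  (forall xi, 0 <= F xi) -> 0 < beta ->
  ((k%:R - beta)%:E < l1dim_of R k F)%E ->
  exists a C : R, [/\ 0 < a, a < beta, 1 <= C &
    forall N M, (0 < N)%N -> (0 < M)%N ->
      \sum_(i < N) dilated_rest F (N + i) M <= C * (N * M)%:R `^ a].
Proof.
move=> F0 b0 /ereal_sup_gt[_ [s [s0 [C0 HC]]] <-]; rewrite lte_fin => sb.
(* The maximum with 0 keeps the exponent nonnegative should s exceed k; [e] below is half of the
   remaining gap to [beta]. *)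
pose a0 := Num.max 0 (k%:R - s).
have a00 : 0 <= a0 by rewrite /a0 le_max lexx.
have a0s : k%:R - s <= a0 by rewrite /a0 le_max lexx orbT.
have a0b : a0 < beta by rewrite /a0 gt_max b0 /=; lra.
pose e := (beta - a0) / 2.
have e0 : 0 < e by rewrite /e; lra.
have [D D1 HD] := divisor_bound R e e0.
pose C := `|C0|.
have C0' : 0 <= C by exact: normr_ge0.
(* The power of 2 pays for the radius 2 N M; [C + 1] rather than [C] makes K >= 1. *)
pose K := D * (C + 1) * (2 : R) `^ (a0 + e).
exists (a0 + e), K; split; [by lra|by rewrite /e; lra| |].
  have p1 : 1 <= (2 : R) `^ (a0 + e).
    rewrite -[leLHS](powRr0 2); apply: ler_powR; [by lra|lra].
  rewrite /K -mulrA; apply: mulr_ege1 => //; apply: mulr_ege1 => //; lra.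
move=> N M N0 M0.
set Q := (N * M).*2.
have Q0 : (0 < Q)%N by rewrite /Q; nia.
have Q1 : 1 <= (Q%:R : R) by rewrite ler1n.
have H1 : \sum_(i < N) dilated_rest F (N + i) M <= (D * (Q%:R : R) `^ e) * box_sum R k Q F.
  apply: sum_dilated_rest_le => // n /andP[n0 nQ].
  apply: (le_trans (HD n n0)); apply: ler_wpM2l; first by lra.
  by apply: ge0_ler_powR; rewrite ?nnegrE ?ler0n ?(ltW e0) // ler_nat.
apply: (le_trans H1).
have H2 : box_sum R k Q F <= (C + 1) * Q%:R `^ a0.
  have := HC _ Q1; have -> : Num.floor (Q%:R : R) = Q%:Z by rewrite -[Q%:R]/(Q%:Z%:~R) intrKfloor.
  rewrite absz_nat => H; apply: (le_trans H).
  apply: (@le_trans _ _ ((C + 1) * Q%:R `^ (k%:R - s))).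
    apply: ler_wpM2r; first exact: powR_ge0.
    by rewrite (le_trans (ler_norm _)) // lerDl.
  by apply: ler_wpM2l; [lra|exact: ler_powR].
apply: (@le_trans _ _ ((D * Q%:R `^ e) * ((C + 1) * Q%:R `^ a0))).
  by apply: ler_wpM2l => //; apply: mulr_ge0; [lra|exact: powR_ge0].
rewrite /K (_ : (Q%:R : R) = 2 * (N * M)%:R); last by rewrite /Q -muln2 natrM mulrC.
set x := (N * M)%:R.
rewrite -[leRHS]mulrA -powRM ?ler0n // powRD; last by rewrite gt_eqF //; lra.
by rewrite le_eqVlt; apply/orP; left; apply/eqP; ring.
Qed.

(** * Distance to the nearest integer and cosine estimates *)

Section DistZ.
Context {R : realType}.
Implicit Types z d : R.

(** An integer q is at most the floor of z or at least its ceiling, so no integer is closer to z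
    than both of these. *)
Lemma distZ_ltP z d : reflect (exists q : int, `|z - q%:~R| < d) (distZ R z < d).
Proof.
have /andP[f1 f2] := floor_itv z.
have /andP[c1 c2] := ceil_itv z.
rewrite intrD in f2; rewrite intrB in c1.
apply: (iffP idP) => [|[q]]; rewrite /distZ gt_min.
  case/orP => h; [exists (Num.floor z)|exists (Num.ceil z)].
    by rewrite ger0_norm //; lra.
  by rewrite ler0_norm; lra.
rewrite ltr_norml => /andP[h1 h2].
have [qz|zq] := leP (q%:~R) z.
  have : q <= Num.floor z by rewrite floor_ge_int.
  rewrite -(ler_int R) => ?; apply/orP; left; lra.
have : Num.ceil z <= q by rewrite ceil_le_int ltW.
by rewrite -(ler_int R) => ?; apply/orP; right; lra.
Qed.

Lemma distZ_ge0 z : 0 <= distZ R z.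
Proof.
by rewrite leNgt; apply/distZ_ltP => -[q]; rewrite ltNge normr_ge0.
Qed.

Lemma distZ_lt1 z : distZ R z < 1.
Proof.
have /andP[f1 f2] := floor_itv z; rewrite intrD in f2.
by rewrite /distZ gt_min; apply/orP; left; lra.
Qed.

Lemma measurable_distZ : measurable_fun setT (distZ R).
Proof.
apply: (@measurability _ _ _ _ _ _ (@RGenInftyO.G R)).
  exact: RGenInftyO.measurableE.
move=> _ [_ [y ->] <-]; rewrite setTI.
rewrite (_ : _ @^-1` _ = \bigcup_(q : int) [set z | `|z - q%:~R| < y]); last first.
  apply/seteqP; split => [z|z [q _ h]]; rewrite /= in_itv /=; last by apply/distZ_ltP; exists q.
  by move/distZ_ltP => [q]; exists q.
apply: countable_bigcupT_measurable => // q.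
rewrite -[X in measurable X]setTI.
apply: measurable_fun_ltr => //; apply: measurableT_comp => //.
by apply: measurable_funB.
Qed.

Lemma cosD2piz (z : int) (a : R) : cos (a + 2 * pi * z%:~R) = cos a.
Proof.
have P n b : cos (b + 2 * pi * n%:R) = cos b :> R.
  rewrite -(periodicn (@cosD2pi R) n b); congr (cos (b + _)).
  by rewrite -[RHS]mulr_natr -[pi *+ 2]mulr_natr; ring.
case: z => n; first exact: P.
rewrite NegzE mulrNz -(P n.+1 (a + _)); congr cos.
by rewrite mulrN addrNK.
Qed.

Lemma cos_piquarter_sqr : (cos (pi / 4) : R) ^+ 2 = 1 / 2.
Proof.
have := @cos_pihalf R.
have -> : (pi / 2 : R) = (pi / 4) *+ 2 by field.
rewrite cos_mulr2n => /eqP; rewrite subr_eq0 => /eqP; rewrite -mulr_natr => h; lra.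
Qed.

(** The constant 1/8 keeps the angle within pi/4, where cosine is decreasing in the absolute value
    of the angle. *)
Lemma cos_piquarter_le (r : R) : `|r| <= 1 / 8 -> cos (pi / 4) <= cos (2 * pi * r).
Proof.
move=> r8; have p0 := @pi_gt0 R.
rewrite -(cos_norm (2 * pi * r)) normrM gtr0_norm; last by lra.
have h1 : pi * `|r| <= pi * (1 / 8) by rewrite ler_pM2l.
have h2 : 0 <= pi * `|r| by apply: mulr_ge0 => //; lra.
rewrite leNgt ltr_cos ?in_itv /=.
- rewrite -leNgt; lra.
- by apply/andP; split; lra.
- by apply/andP; split; lra.
Qed.

End DistZ.

(** * Fejer kernel bound for the measure of a neighbourhood *)

Section FejerMajorant.
Context {R : realType} {d : measure_display} {T : measurableType d}.
Context (P : probability T R) (D : set T) (mD : measurable D).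
Context {k : nat} (X : 'I_k -> T -> R) (mX : forall j, measurable_fun setT (X j)).

(** The coordinates are abstract functions [X j] on a probability space, so that one bound serves
    both for measures on R^k and, with a single coordinate, for the factors of a product measure. *)
Definition phase (xi : 'I_k -> int) (x : T) : R := \sum_(j < k) (xi j)%:~R * X j x.

Definition charfun_abs (xi : 'I_k -> int) : R :=
  Num.sqrt (Rintegral P D (fun x => cos (2 * pi * phase xi x)) ^+ 2
          + Rintegral P D (fun x => sin (2 * pi * phase xi x)) ^+ 2).

Lemma measurable_phase xi : measurable_fun setT (phase xi).
Proof.
apply: measurable_sum => j; apply: measurable_funM => //.
Qed.

Lemma measurable_cos_phase xi (c : R) :
  measurable_fun setT (fun x => cos (2 * pi * phase xi x + c)).
Proof.
apply: measurableT_comp; first by apply: continuous_measurable_fun; exact: continuous_cos.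
apply: measurable_funD; last exact: measurable_cst.
apply: measurable_funM; [exact: measurable_cst|exact: measurable_phase].
Qed.

Lemma measurable_sin_phase xi :
  measurable_fun setT (fun x => sin (2 * pi * phase xi x)).
Proof.
apply: measurableT_comp; first by apply: continuous_measurable_fun; exact: continuous_sin.
by apply: measurable_funM; [exact: measurable_cst|exact: measurable_phase].
Qed.

Lemma integrable_bounded1 (f : T -> R) : measurable_fun setT f ->
  (forall x, `|f x| <= 1) -> P.-integrable D (EFin \o f).
Proof.
move=> mf f1; apply: measurable_bounded_integrable => //.
- by rewrite (le_lt_trans (probability_le1 _ _)) // ltry.
- exact: measurable_funTS.
- exists 1; split => // M M1 x _ /=; apply: le_trans (f1 x) _; exact: ltW.
Qed.

(** With A and B the cosine and sine integrals, the left side is A cos c + B sin c, and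
    Cauchy-Schwarz bounds it by the modulus of the coefficient. *)
Lemma integral_cos_shift xi (c : R) :
  (\int[P]_(x in D) (cos (2 * pi * phase xi x - c))%:E <= (charfun_abs xi)%:E)%E.
Proof.
have mc := measurable_cos_phase xi 0.
have {}mc : measurable_fun setT (fun x => cos (2 * pi * phase xi x)).
  by move: mc; under eq_fun do rewrite addr0.
have ms := measurable_sin_phase xi.
have ic := integrable_bounded1 _ mc (fun x => cos_max _).
have isn := integrable_bounded1 _ ms (fun x => sin_max _).
have icc : P.-integrable D (EFin \o (fun x => cos (2 * pi * phase xi x - c))).
  by apply: integrable_bounded1 => [|x]; [exact: measurable_cos_phase|exact: cos_max].
rewrite -[leLHS]fineK; last exact: integrable_fin_num icc.
rewrite lee_fin -/(Rintegral P D (fun x => cos (2 * pi * phase xi x - c))).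
under eq_Rintegral do rewrite cosB [X in X + _]mulrC [X in _ + X]mulrC.
rewrite RintegralD //; first last.
- by have := integrableZl mD (sin c) isn.
- by have := integrableZl mD (cos c) ic.
rewrite !RintegralZl // /charfun_abs.
set A := Rintegral _ _ _; set B := Rintegral _ _ _.
apply: (le_trans (ler_norm _)); rewrite -sqrtr_sqr ler_wsqrtr //.
have := sqr_ge0 (A * sin c - B * cos c).
have E := cos2Dsin2 c.
have -> : A ^+ 2 + B ^+ 2 = (A ^+ 2 + B ^+ 2) * (cos c ^+ 2 + sin c ^+ 2) by rewrite E mulr1.
nra.
Qed.

Lemma charfun_abs_ge0 xi : 0 <= charfun_abs xi.
Proof. exact: sqrtr_ge0. Qed.

Lemma charfun_abs0_le1 : charfun_abs (fun=> 0) <= 1.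
Proof.
rewrite /charfun_abs (_ : phase (fun=> 0) = fun=> 0); last first.
  by apply/funext => x; rewrite /phase big1 // => j _; rewrite mul0r.
rewrite mulr0 cos0 sin0 !Rintegral_cst // mul0r expr0n addr0 mul1r.
rewrite sqrtr_sqr ger0_norm ?fine_ge0 //.
have PD := @probability_le1 _ _ _ P D mD.
by rewrite -lee_fin fineK // fin_num_measure.
Qed.

(** For each of the M^k choices of m', the map m -> m - m' is injective into the box of radius M -
    1. In effect the triangular Fejer weights are replaced by M^k. *)
Lemma sum_diff_le_box_sum (F : ('I_k -> int) -> R) (M : nat) :
  (forall xi, 0 <= F xi) ->
  \sum_(m : {ffun 'I_k -> 'I_M}) \sum_(m' : {ffun 'I_k -> 'I_M})
     F (fun j => (m j)%:Z - (m' j)%:Z) <= M%:R ^+ k * box_sum R k M.-1 F.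
Proof.
move=> F0; rewrite exchange_big /=.
have -> : M%:R ^+ k * box_sum R k M.-1 F =
    \sum_(m' : {ffun 'I_k -> 'I_M}) box_sum R k M.-1 F.
  by rewrite sumr_const card_ffun !card_ord -[RHS]mulr_natl natrX.
apply: ler_sum => m' _.
pose h (m : {ffun 'I_k -> 'I_M}) : {ffun 'I_k -> 'I_(M.-1.*2.+1)} :=
  [ffun j => inord (m j + M.-1 - m' j)].
have hE m j : (h m j)%:Z - (M.-1)%:Z = (m j)%:Z - (m' j)%:Z.
  have := ltn_ord (m j); have := ltn_ord (m' j) => a b.
  rewrite ffunE inordK; lia.
have h_inj : injective h.
  move=> m1 m2 e; apply/ffunP => j; apply/val_inj => /=.
  have := hE m1 j; rewrite e hE; lia.
pose G (b : {ffun 'I_k -> 'I_(M.-1.*2.+1)}) := F (fun j => (b j)%:Z - (M.-1)%:Z).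
rewrite (eq_bigr (fun m => G (h m))); last first.
  by move=> m _; congr F; apply/funext => j; rewrite hE.
rewrite -(big_imset G (A := predT)) /=; last by move=> ? ? _ _; exact: h_inj.
rewrite /box_sum -/G [leRHS](bigID (mem (h @: predT))) /= lerDl.
exact: sumr_ge0.
Qed.

(** Both sides are the squared modulus of the sum of exp(i t), in real terms. *)
Lemma cos_sum_sqr (I : finType) (t : I -> R) :
  \sum_i \sum_j cos (t i - t j) = (\sum_i cos (t i)) ^+ 2 + (\sum_i sin (t i)) ^+ 2.
Proof.
rewrite !expr2 !big_distrlr /= -big_split /=; apply: eq_bigr => i _.
by rewrite -big_split /=; apply: eq_bigr => j _; rewrite cosB.
Qed.

(** Replacing each z_j by its nearby integer moves m . z by at most k (M - 1) delta <= 1/8. *)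
Lemma cos_sum_lower (M : nat) (delta : R) (z : 'I_k -> R) (m : {ffun 'I_k -> 'I_M}) :
  0 <= delta -> k%:R * (M.-1)%:R * delta <= 1 / 8 ->
  (forall j, distZ R (z j) < delta) ->
  cos (pi / 4) <= cos (2 * pi * \sum_(j < k) (m j)%:R * z j).
Proof.
move=> d0 kMd zd.
have /choice[q qz] : forall j, exists q : int, `|z j - q%:~R| < delta.
  by move=> j; exact/distZ_ltP.
pose Z : int := \sum_(j < k) (m j)%:Z * q j.
pose r := \sum_(j < k) (m j)%:R * (z j - (q j)%:~R).
have -> : 2 * pi * \sum_(j < k) (m j)%:R * z j = 2 * pi * r + 2 * pi * Z%:~R.
  rewrite -mulrDr; congr (_ * _); rewrite /r /Z raddf_sum /= -big_split /=.
  by apply: eq_bigr => j _; rewrite intrM; ring.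
rewrite cosD2piz; apply: cos_piquarter_le.
apply: (le_trans _ kMd); apply: (le_trans (ler_norm_sum _ _ _)).
have -> : k%:R * (M.-1)%:R * delta = \sum_(j < k) (M.-1)%:R * delta.
  by rewrite sumr_const card_ord -mulrA mulr_natl.
apply: ler_sum => j _; rewrite normrM normr_nat.
apply: ler_pM => //; last exact/ltW/qz.
by rewrite ler_nat; have := ltn_ord (m j); lia.
Qed.

Definition near_set (n : nat) (y : 'I_k -> R) (delta : R) : set T :=
  D `&` [set x | forall j, distZ R (n%:R * X j x - y j) < delta].

Lemma measurable_near n y delta : measurable (near_set n y delta).
Proof.
apply: measurableI => //.
rewrite (_ : mkset _ = \bigcap_(j : 'I_k) [set x | distZ R (n%:R * X j x - y j) < delta]); last first.
  by apply/seteqP; split => x /= h; [move=> j _; exact: h|move=> j; exact: h].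
apply: fin_bigcap_measurable => // j _.
rewrite -[X in measurable X]setTI.
apply: measurable_fun_ltr => //; apply: measurableT_comp; first exact: measurable_distZ.
by apply: measurable_funB => //; apply: measurable_funM.
Qed.

(* The majorant of the indicator function is the Fejer kernel
   |\sum_m e(m . z)|^2, m ranging over {0..M-1}^k. *)
Lemma near_measure_le (n M : nat) (y : 'I_k -> R) (delta : R) :
  (0 < M)%N -> 0 <= delta -> k%:R * (M.-1)%:R * delta <= 1 / 8 ->
  (P (near_set n y delta) <=
   (2 / M%:R ^+ k * (1 + dilated_rest charfun_abs n M))%:E)%E.
Proof.
move=> M0 d0 kMd; set S := near_set n y delta.
have mS : measurable S by exact: measurable_near.
(* The pair (m, m') contributes a cosine of frequency n (m - m'); the centre y enters only through
   the constant shift [c p]. *)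
pose xi (p : {ffun 'I_k -> 'I_M} * {ffun 'I_k -> 'I_M}) := fun j => n%:Z * ((p.1 j)%:Z - (p.2 j)%:Z).
pose c (p : {ffun 'I_k -> 'I_M} * {ffun 'I_k -> 'I_M}) := 2 * pi * \sum_(j < k) ((p.1 j)%:R - (p.2 j)%:R) * y j.
pose g p x := cos (2 * pi * phase (xi p) x - c p).
pose t x (m : {ffun 'I_k -> 'I_M}) := 2 * pi * \sum_(j < k) (m j)%:R * (n%:R * X j x - y j).
have gt x : \sum_p g p x = (\sum_m cos (t x m)) ^+ 2 + (\sum_m sin (t x m)) ^+ 2.
  rewrite -cos_sum_sqr pair_big /=; apply: eq_bigr => p _.
  rewrite /g /c /t /phase -!mulrBr -!sumrB; congr (cos (_ * _)).
  by apply: eq_bigr => j _; rewrite /xi intrM intrB; ring.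
have Mk0 : 0 < (M%:R : R) ^+ k by rewrite exprn_gt0 // ltr0n.
have ig p : P.-integrable D (EFin \o g p).
  by apply: integrable_bounded1 => [|x]; [exact: measurable_cos_phase|exact: cos_max].
(* L is (M^k cos(pi/4))^2, a lower bound for the kernel on [S]. *)
pose L := (M%:R ^+ k) ^+ 2 / 2 : R.
have L0 : 0 < L by rewrite /L divr_gt0 // exprn_gt0.
have lowS x : S x -> L <= \sum_p g p x.
  move=> [_ /= Sx]; rewrite gt.
  have h : M%:R ^+ k * cos (pi / 4) <= \sum_m cos (t x m).
    have -> : M%:R ^+ k * cos ((pi : R) / 4) = \sum_(m : {ffun 'I_k -> 'I_M}) cos (pi / 4).
      by rewrite sumr_const card_ffun !card_ord -[RHS]mulr_natl natrX.
    by apply: ler_sum => m _; apply: (cos_sum_lower M delta).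
  have c0 : 0 <= cos (pi / 4) :> R.
    by apply: cos_ge0_pihalf; have := @pi_gt0 R; lra.
  have -> : L = (M%:R ^+ k * cos (pi / 4)) ^+ 2 by rewrite exprMn cos_piquarter_sqr /L; ring.
  apply: ler_wpDr; first exact: sqr_ge0.
  apply: lerXn2r => //; rewrite nnegrE; first by apply: mulr_ge0 => //; exact: ltW.
  by apply: le_trans h; apply: mulr_ge0 => //; exact: ltW.
have mg : measurable_fun setT (fun x => \sum_p g p x).
  by apply: measurable_sum => p; exact: measurable_cos_phase.
(* Markov's inequality; passing from [S] to [D] uses that the kernel is a sum of two squares. *)
have step1 : (L%:E * P S <= \int[P]_(x in D) (\sum_p g p x)%:E)%E.
  rewrite -integral_cst //.
  apply: (@le_trans _ _ (\int[P]_(x in S) (\sum_p g p x)%:E)%E).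
    apply: ge0_le_integral => //.
    - by move=> x _; rewrite lee_fin ltW.
    - by apply/measurable_EFinP; apply: measurable_funTS.
  apply: ge0_subset_integral => //.
  - by apply/measurable_EFinP; apply: measurable_funTS.
  - by move=> x _; rewrite lee_fin gt addr_ge0 // sqr_ge0.
  - by move=> x [].
have step2 : (\int[P]_(x in D) (\sum_p g p x)%:E <= (\sum_p charfun_abs (xi p))%:E)%E.
  under eq_integral do rewrite -sumEFin.
  rewrite (integral_sum mD ig) -sumEFin; apply: lee_sum => p _.
  exact: integral_cos_shift.
have step3 : \sum_p charfun_abs (xi p) <=
    M%:R ^+ k * (1 + dilated_rest charfun_abs n M).
  pose F h := charfun_abs (fun j => n%:Z * h j).
  have := @sum_diff_le_box_sum F M (fun h => charfun_abs_ge0 _).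
  rewrite pair_big /= => /le_trans; apply; apply: ler_wpM2l; first exact: ltW.
  rewrite /dilated_rest -/F addrCA lerDl subr_ge0; exact: charfun_abs0_le1.
have := le_trans step1 (le_trans step2 _).
move/(_ (M%:R ^+ k * (1 + dilated_rest charfun_abs n M))%:E).
rewrite lee_fin => /(_ step3).
rewrite -[P S]fineK ?fin_num_measure // -EFinM !lee_fin => h.
rewrite -(ler_pM2l L0); apply: (le_trans h).
by rewrite /L le_eqVlt; apply/orP; left; apply/eqP; field; lra.
Qed.

End FejerMajorant.

(** * Bounded partial sums and Cauchy condensation *)

Section BoundedSums.
Context {R : realType}.
Implicit Types u v f : nat -> R.

Definition bounded_sums u := exists B : R, forall n, \sum_(i < n) u i <= B.

Lemma bounded_sums_le u v : (forall n, u n <= v n) -> bounded_sums v -> bounded_sums u.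
Proof.
move=> uv [B HB]; exists B => n; apply: le_trans (HB n).
by apply: ler_sum => i _.
Qed.

Lemma bounded_sumsD u v : bounded_sums u -> bounded_sums v ->
  bounded_sums (fun n => u n + v n).
Proof.
move=> [B HB] [C HC]; exists (B + C) => n.
by rewrite big_split lerD.
Qed.

Lemma bounded_sumsZ u c : 0 <= c -> bounded_sums u -> bounded_sums (fun n => c * u n).
Proof.
move=> c0 [B HB]; exists (c * B) => n.
by rewrite -mulr_sumr ler_wpM2l.
Qed.

Lemma bounded_sums_shift u : (forall n, 0 <= u n) ->
  bounded_sums (fun n => u n.+1) -> bounded_sums u.
Proof.
move=> u0 [B HB]; exists (u 0%N + B) => -[|n].
  rewrite big_ord0 addr_ge0 //; have := HB 0%N; by rewrite big_ord0.
by rewrite big_ord_recl lerD2l; exact: HB.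
Qed.

Lemma bounded_sums_unshift u : (forall n, 0 <= u n) ->
  bounded_sums u -> bounded_sums (fun n => u n.+1).
Proof.
move=> u0 [B HB]; exists B => n; apply: le_trans (HB n.+1).
by rewrite big_ord_recl lerDr.
Qed.

Lemma bounded_sums_geometric (q : R) : 0 <= q -> q < 1 -> bounded_sums (fun n => q ^+ n).
Proof.
move=> q0 q1; exists ((1 - q)^-1) => n.
have h : 0 < 1 - q by lra.
have E : (1 - q) * \sum_(i < n) q ^+ i = 1 - q ^+ n.
  elim: n => [|n IH]; first by rewrite big_ord0 expr0 mulr0 subrr.
  by rewrite big_ord_recr /= mulrDr IH exprS; ring.
rewrite -(ler_pM2l h) E mulfV ?gt_eqF // lerBlDr lerDl; exact: exprn_ge0.
Qed.

(** With r the square root of q, the polynomial is at most C r^(-n), which leaves the geometric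
    series in r. *)
Lemma bounded_sums_poly_geometric (j : nat) (q : R) : 0 < q -> q < 1 ->
  bounded_sums (fun n => (n.+1%:R) ^+ j * q ^+ n).
Proof.
move=> q0 q1; pose r := Num.sqrt q.
have r0 : 0 < r by rewrite sqrtr_gt0.
have r1 : r < 1 by rewrite -sqrtr1 ltr_sqrt.
have ri : 1 < r^-1 by rewrite invf_gt1.
have [C C1 HC] := poly_le_geometric R j _ ri.
apply: (@bounded_sums_le _ (fun n => C * r ^+ n)); last first.
  by apply: bounded_sumsZ; [lra|apply: bounded_sums_geometric => //; exact: ltW].
move=> n; have -> : q ^+ n = r ^+ n * r ^+ n.
  by rewrite -exprMn -expr2 sqr_sqrtr // ltW.
rewrite mulrA ler_pM2r ?exprn_gt0 // -ler_pdivlMr ?exprn_gt0 // -exprVn.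
exact: HC.
Qed.

Lemma nneseries_bounded_sums u : (forall n, 0 <= u n) -> bounded_sums u ->
  (\sum_(n <oo) (u n)%:E < +oo)%E.
Proof.
move=> u0 [B HB]; apply: (@le_lt_trans _ _ B%:E); last exact: ltry.
apply: lime_le; first by apply: is_cvg_nneseries => n _ _; rewrite lee_fin.
by apply: nearW => n; rewrite big_mkord sumEFin lee_fin.
Qed.

Lemma bounded_partial_sums f : (forall n, (0 < n)%N -> 0 <= f n) ->
  (\sum_(1 <= n <oo) (f n)%:E < +oo)%E ->
  exists B : R, forall n, \sum_(1 <= i < n) f i <= B.
Proof.
move=> f0 fin.
have ge0 n : (1 <= n)%N -> predT n -> (0%:E <= (f n)%:E)%E by move=> n1 _; rewrite lee_fin f0.
set S := (\sum_(1 <= n <oo) (f n)%:E)%E in fin.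
have S0 : (0 <= S)%E by apply: le_trans (@nneseries_lim_ge _ _ predT 1 0 ge0); rewrite big_geq.
exists (fine S) => n; rewrite -lee_fin fineK ?ge0_fin_numE //.
by rewrite -sumEFin; exact: (@nneseries_lim_ge _ _ predT 1 n ge0).
Qed.

(** A lower bound [v m] on each dyadic block replaces monotonicity of f, because psi(n) (log
    n)^(k-1) need not be monotone. A block contains 2^m integers. *)
Lemma condensation_bounded f v :
  (forall n, (0 < n)%N -> 0 <= f n) ->
  (\sum_(1 <= n <oo) (f n)%:E < +oo)%E ->
  (forall m n, (2 ^ m <= n < 2 ^ m.+1)%N -> v m <= f n) ->
  bounded_sums (fun m => 2 ^+ m * v m).
Proof.
move=> f0 /(bounded_partial_sums _ f0)[B HB] fv; exists B => L.
apply: le_trans (HB (2 ^ L)%N).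
elim: L => [|L IH]; first by rewrite big_ord0 big_geq.
rewrite big_ord_recr /= (@big_cat_nat _ _ _ (2 ^ L)%N) /=; first last.
- by rewrite leq_exp2l.
- by rewrite expn_gt0.
apply: lerD => //.
have -> : 2 ^+ L * v L = \sum_(2 ^ L <= i < 2 ^ L.+1) v L.
  by rewrite sumr_const_nat expnS mul2n -addnn addnK -[RHS]mulr_natl natrX.
by apply: ler_sum_nat => i; exact: fv.
Qed.

End BoundedSums.

(** * Borel-Cantelli over dyadic blocks *)

Section BorelCantelli.
Context {R : realType} {d : measure_display} {T : measurableType d}.
Context (P : probability T R).

Lemma measure_bigsetU_le (I : Type) (s : seq I) (p : pred I) (A : I -> set T) :
  (forall i, measurable (A i)) ->
  (P (\big[setU/set0]_(i <- s | p i) A i) <= \sum_(i <- s | p i) P (A i))%E.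
Proof.
move=> mA; elim: s => [|i s IH]; first by rewrite !big_nil measure0.
rewrite !big_cons; case: (p i) => //.
apply: le_trans (leeD2l _ IH); apply: measureU2 => //.
exact: bigsetU_measurable.
Qed.

Lemma infinite_natP (A : set nat) :
  infinite_set A <-> forall N, exists2 n, (N <= n)%N & A n.
Proof.
split=> [iA N|H /finite_seqP[s As]].
  apply: contrapT => nA; apply: iA; apply: (sub_finite_set _ (finite_II N)) => n An /=.
  by rewrite ltnNge; apply/negP => Nn; apply: nA; exists n.
have [n] := H (\max_(i <- s) i).+1.
rewrite As /= => h ns; move: h; apply/negP; rewrite -leqNgt.
exact: (@leq_bigmax_seq _ s predT id n ns isT).
Qed.

(** The union of the [E' m i] over a block has measure at most [u m], and a point in infinitely many
    [E n] meets infinitely many blocks. The larger sets [E'] allow a radius that is constant on the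
    block. *)
Lemma borel_cantelli_dyadic (D : set T) (E : nat -> set T) (E' : nat -> nat -> set T)
    (u : nat -> R) :
  measurable D -> (forall n, measurable (E n)) ->
  (forall m i, measurable (E' m i)) ->
  (forall m i, (i < 2 ^ m)%N -> D `&` E (2 ^ m + i)%N `<=` E' m i) ->
  (forall m, (\sum_(i < 2 ^ m) P (E' m i) <= (u m)%:E)%E) ->
  bounded_sums u ->
  P [set x | D x /\ infinite_set [set n | (0 < n)%N /\ E n x]] = 0%E.
Proof.
move=> mD mE mE' EE' Eu bu.
have u0 m : 0 <= u m.
  by rewrite -lee_fin; apply: le_trans (Eu m); apply: sume_ge0.
pose B m := \big[setU/set0]_(i < 2 ^ m) E' m i.
have mB m : measurable (B m) by exact: bigsetU_measurable.
have PB m : (P (B m) <= (u m)%:E)%E.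
  apply: le_trans (Eu m); exact: measure_bigsetU_le.
have B0 : P (lim_sup_set B) = 0%E.
  apply: lim_sup_set_cvg0 => //.
  apply: le_lt_trans (nneseries_bounded_sums _ u0 bu).
  by apply: lee_nneseries => // m _; exact: PB.
set W := mkset _.
(* The index shift encodes the condition 0 < n and yields measurability of [W]. *)
have WE : W = D `&` lim_sup_set (fun n => E n.+1).
  apply/seteqP; split=> x /= [Dx].
    move/infinite_natP => H; split => // N _.
    have [[|n] Nn [//= _ En]] := H N.+1.
    by exists n.
  move=> H; split => //; apply/infinite_natP => N.
  have [n /= Nn En] := H N I.
  by exists n.+1 => //; exact: leqW.
have mW : measurable W.
  rewrite WE; apply: measurableI => //; apply: bigcap_measurable => // N _.
  by apply: bigcup_measurable.
have mL : measurable (lim_sup_set B).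
  by apply: bigcap_measurable => // N _; apply: bigcup_measurable.
apply/eqP; rewrite eq_le measure_ge0 andbT -B0.
apply: le_measure; rewrite ?inE // => x [Dx /infinite_natP H] N _.
(* Any n >= 2^N lies in a block of index at least N. *)
have [n Nn [n0 En]] := H (2 ^ N)%N.
have := trunc_log_bounds (isT : 1 < 2)%N n0.
set m := trunc_log 2 n => /= /andP[h1 h2].
exists m; first by apply: trunc_log_max.
rewrite /B -bigcup_mkord; exists (n - 2 ^ m)%N => /=.
  by rewrite expnS in h2; lia.
apply: EE'; first by rewrite expnS in h2; lia.
by split => //; rewrite subnKC.
Qed.

End BorelCantelli.

(** * Powers of two, and measurability of the sets involved *)

Section Dyadic.
Context {R : realType}.

Lemma powR_pow2 (m : nat) (x : R) : (2 ^ m)%:R `^ x = (2 `^ x) ^+ m.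
Proof. by rewrite natrX -powR_mulrn ?ler0n // powRAC powR_mulrn ?powR_ge0. Qed.

Lemma powR2N_lt1 (x : R) : 0 < x -> 0 < 2 `^ (- x) :> R /\ 2 `^ (- x) < 1 :> R.
Proof.
move=> x0; rewrite powR_gt0 //; split => //.
rewrite powRN invf_lt1 ?powR_gt0 // -[ltLHS](powRr0 2) /powR.
by case: eqP => [|_]; [lra|rewrite ltr_expR ltr_pM2r // ln_gt0; lra].
Qed.

Lemma max_pow_le (x y : R) (k : nat) : 0 <= x -> 0 <= y ->
  Num.max x y ^+ k <= x ^+ k + y ^+ k.
Proof.
by move=> x0 y0; case: (leP x y) => _; rewrite ?lerDl ?lerDr exprn_ge0.
Qed.

End Dyadic.

Section Coordinates.
Context {R : realType} {k : nat}.

Lemma measurable_cube01 : measurable (cube01 R k).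
Proof.
rewrite (_ : cube01 R k = \bigcap_(j : 'I_k) ((fun x : k.-tuple R => tnth x j) @^-1` `[0, 1]%classic)).
  apply: fin_bigcap_measurable => // j _; rewrite -[X in measurable X]setTI.
  exact: measurable_tnth.
apply/seteqP; split => x /= h j; first by move=> _ /=; rewrite in_itv /=; exact: h.
by have := h j I; rewrite /= in_itv.
Qed.

Lemma measurable_cube01ho : measurable (cube01ho R k).
Proof.
rewrite (_ : cube01ho R k = \bigcap_(j : 'I_k) ((fun x : k.-tuple R => tnth x j) @^-1` `[0, 1[%classic)).
  apply: fin_bigcap_measurable => // j _; rewrite -[X in measurable X]setTI.
  exact: measurable_tnth.
apply/seteqP; split => x /= h j; first by move=> _ /=; rewrite in_itv /=; exact: h.
by have := h j I; rewrite /= in_itv.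
Qed.

Lemma cube01ho_sub : cube01ho R k `<=` cube01 R k.
Proof. by move=> x h j; have /andP[-> /ltW ->] := h j. Qed.

Lemma measurable_distZ_coord (n : nat) (y : R) (j : 'I_k) :
  measurable_fun setT (fun x : k.-tuple R => distZ R (n%:R * tnth x j - y)).
Proof.
apply: measurableT_comp; first exact: measurable_distZ.
apply: measurable_funB => //; apply: measurable_funM => //; exact: measurable_tnth.
Qed.

Lemma measurable_bigmax_distZ (n : nat) (y : k.-tuple R) (c : R) :
  measurable [set x : k.-tuple R |
    \big[Num.max/0]_(j < k) distZ R (n%:R * tnth x j - tnth y j) < c].
Proof.
rewrite -[X in measurable X]setTI; apply: measurable_fun_ltr => //.
elim: (index_enum _) => [|j s IH]; first by under eq_fun do rewrite big_nil; exact: measurable_cst.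
under eq_fun do rewrite big_cons.
by apply: measurable_maxr => //; exact: measurable_distZ_coord.
Qed.

Lemma measurable_prod_distZ (n : nat) (y : k.-tuple R) (c : R) :
  measurable [set x : k.-tuple R |
    \prod_(j < k) distZ R (n%:R * tnth x j - tnth y j) < c].
Proof.
rewrite -[X in measurable X]setTI; apply: measurable_fun_ltr => //.
by apply: measurable_prod => j _; exact: measurable_distZ_coord.
Qed.

End Coordinates.

(** * The Khinchin statement *)

Section Khinchin.
Context {R : realType} {k : nat} (k0 : (0 < k)%N) (mu : probability (k.-tuple R) R).

Let X (j : 'I_k) (x : k.-tuple R) := tnth x j.

(** The lower bound on delta gives M = O(N^((1 + eta)/k)), and the relation between a and eta says
    exactly that the a-th power of N^(1 + (1 + eta)/k) is N. Hence the nonzero frequencies cost O(N)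
    in total, like the zero one. *)
Lemma khinchin_block (a C eta delta : R) (y : 'I_k -> R) (N : nat) :
  0 < a -> 1 <= C -> 0 < eta -> a * (k%:R + 1 + eta) = k%:R ->
  (forall N M, (0 < N)%N -> (0 < M)%N ->
      \sum_(i < N) dilated_rest (fourier_abs R k mu) (N + i) M <= C * (N * M)%:R `^ a) ->
  (0 < N)%N -> 0 < delta <= 1 -> N%:R `^ (- (1 + eta) / k%:R) <= delta ->
  (\sum_(i < N) mu (near_set (cube01 R k) X (N + i) y delta) <=
    (2 * (8 * k%:R) ^+ k * (1 + C * 2 `^ a) * (N%:R * delta ^+ k))%:E)%E.
Proof.
move=> a0 C1 eta0 aE HC N0 /andP[d0 d1] dN.
have kR : 0 < (k%:R : R) by rewrite ltr0n.
have k1 : 1 <= (k%:R : R) by rewrite ler1n.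
have NR : 1 <= (N%:R : R) by rewrite ler1n.
(* With M the integer part of w plus 1, M - 1 <= w gives the kernel condition k (M - 1) delta <=
   1/8, while M >= w gives 1/M^k <= (8 k delta)^k. *)
pose w := (8 * k%:R * delta)^-1.
have w0 : 0 < 8 * k%:R * delta by rewrite !mulr_gt0.
have iw0 : 0 < w by rewrite invr_gt0.
pose M := (Num.truncn w).+1.
have M0 : (0 < M)%N by [].
have Mlow : w <= M%:R by apply/ltW/truncnS_gt.
have Mup : (M.-1)%:R <= w by rewrite /M /= truncn_le ltW.
have kMd : k%:R * (M.-1)%:R * delta <= 1 / 8.
  have : 8 * k%:R * delta * (M.-1)%:R <= 8 * k%:R * delta * w by rewrite ler_pM2l.
  rewrite /w mulfV ?gt_eqF //; lra.
have mX j : measurable_fun setT (X j) by exact: measurable_tnth.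
apply: (@le_trans _ _ (\sum_(i < N) (2 / M%:R ^+ k *
    (1 + dilated_rest (fourier_abs R k mu) (N + i) M))%:E)%E).
  apply: lee_sum => i _.
  exact: (near_measure_le mu _ measurable_cube01 X mX _ _ _ _ M0 (ltW d0) kMd).
rewrite sumEFin lee_fin -mulr_sumr big_split /= sumr_const card_ord.
have Mk : 0 < (M%:R : R) ^+ k by rewrite exprn_gt0 // ltr0n.
have h1 : 2 / M%:R ^+ k <= 2 * (8 * k%:R) ^+ k * delta ^+ k.
  rewrite -mulrA -exprMn ler_pM2l // -[leRHS]invrK lef_pV2 ?posrE ?invr_gt0 ?exprn_gt0 //.
  rewrite -exprVn; apply: lerXn2r => //; rewrite nnegrE ?ler0n //; exact: ltW.
have h2 : (N * M)%:R `^ a <= 2 `^ a * N%:R.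
  have Md : M%:R <= 2 / delta.
    have wd : w <= delta^-1.
      rewrite lef_pV2 ?posrE //; nra.
    have d1' : 1 <= delta^-1 by rewrite invf_ge1.
    have -> : (M%:R : R) = (M.-1)%:R + 1 by rewrite natr1.
    lra.
  have dV : delta^-1 <= N%:R `^ ((1 + eta) / k%:R).
    rewrite -[leRHS]invrK -powRN lef_pV2 ?posrE ?powR_gt0 ?invr_gt0 //; last by lra.
    by rewrite -mulNr.
  have step : (N * M)%:R <= 2 * N%:R `^ (1 + (1 + eta) / k%:R).
    rewrite natrM powRD; last by rewrite pnatr_eq0 -lt0n N0 implybT.
    rewrite powRr1 ?ler0n // mulrCA; apply: ler_pM; rewrite ?ler0n //.
    by apply: (le_trans Md); rewrite ler_pM2l.
  apply: (@le_trans _ _ ((2 * N%:R `^ (1 + (1 + eta) / k%:R)) `^ a)).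
    by apply: ge0_ler_powR; rewrite ?nnegrE ?ler0n ?(ltW a0) ?mulr_ge0 ?powR_ge0.
  rewrite powRM ?powR_ge0 // -powRrM (_ : (1 + (1 + eta) / k%:R) * a = 1); last first.
    have -> : (1 + (1 + eta) / k%:R) * a = a * (k%:R + 1 + eta) / k%:R by field; lra.
    by rewrite aE mulfV // gt_eqF.
  by rewrite powRr1 ?ler0n.
have h3 := HC N M N0 M0.
have h4 : N%:R + \sum_(i < N) dilated_rest (fourier_abs R k mu) (N + i) M <=
    (1 + C * 2 `^ a) * N%:R.
  rewrite mulrDl mul1r lerD2l; apply: (le_trans h3).
  by rewrite -mulrA ler_pM2l //; lra.
have h5 : 0 <= N%:R + \sum_(i < N) dilated_rest (fourier_abs R k mu) (N + i) M.
  apply: addr_ge0 => //; apply: sumr_ge0 => i _; apply: dilated_rest_ge0 => xi; exact: sqrtr_ge0.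
apply: (le_trans (ler_pM _ h5 h1 h4)); first by rewrite divr_ge0 // ltW.
by rewrite le_eqVlt; apply/orP; left; apply/eqP; ring.
Qed.

Lemma khinchin_of_dim :
  ((k%:R - k%:R / (k.+1)%:R)%:E < dim_l1 R k mu)%E -> inhom_conv_Khinchin R k mu.
Proof.
move=> dimk psi [psi01 psi_dec] psi_sum y.
have kR : 0 < (k%:R : R) by rewrite ltr0n.
have k1R : 0 < (k.+1%:R : R) by rewrite ltr0n.
have b0 : 0 < (k%:R / k.+1%:R : R) by rewrite divr_gt0.
have [a [C [a0 ab C1 HC]]] := l1dim_dilated_rest R k _ _ (fun xi => sqrtr_ge0 _) b0 dimk.
(* Positivity of [eta] is the inequality a < k/(k + 1). *)
pose eta := k%:R / a - (k%:R + 1).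
have eta0 : 0 < eta.
  rewrite subr_gt0 ltr_pdivlMr // natr1 mulrC -ltr_pdivlMr //.
have aE : a * (k%:R + 1 + eta) = k%:R by rewrite /eta; field; rewrite gt_eqF.
(* The floor imposed on psi adds at most 2^m (2^m)^(-(1 + eta)) = 2^(-eta m) to the m-th block sum,
   up to a constant. *)
pose delta m := Num.max (psi (2 ^ m)%N) ((2 ^ m)%:R `^ (- (1 + eta) / k%:R)).
have p2 m : (0 < 2 ^ m)%N by rewrite expn_gt0.
pose q : R := 2 `^ (- eta).
have [q0 q1] := powR2N_lt1 eta eta0.
pose K := 2 * (8 * k%:R) ^+ k * (1 + C * 2 `^ a).
have K0 : 0 <= K.
  rewrite /K; apply: mulr_ge0; first by rewrite mulr_ge0 // exprn_ge0 // mulr_ge0.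
  by rewrite addr_ge0 // mulr_ge0 ?powR_ge0 //; lra.
have d01 m : 0 < delta m <= 1.
  rewrite /delta lt_max powR_gt0 ?ltr0n // orbT /= ge_max.
  have /andP[_ /ltW ->] := psi01 _ (p2 m).
  rewrite -[leRHS](powRr0 (2 ^ m)%:R) ler_powR ?ler1n //.
  by rewrite mulNr oppr_le0 divr_ge0 //; lra.
apply: (borel_cantelli_dyadic mu (cube01ho R k)
  (fun n => [set x | \big[Num.max/0]_(j < k) distZ R (n%:R * tnth x j - tnth y j) < psi n])
  (fun m i => near_set (cube01 R k) X (2 ^ m + i) (tnth y) (delta m))
  (fun m => K * ((2 ^ m)%:R * delta m ^+ k))).
- exact: measurable_cube01ho.
- by move=> n; exact: measurable_bigmax_distZ.
- move=> m i; apply: measurable_near; first exact: measurable_cube01.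
  by move=> j; exact: measurable_tnth.
- move=> m i im x [/cube01ho_sub Dx /= h]; split => // j.
  apply: (@lt_le_trans _ _ (psi (2 ^ m + i)%N)).
    by move/bigmax_ltP : h => [_]; exact.
  by rewrite /delta le_max psi_dec // leq_addr.
- move=> m; apply: (khinchin_block a C eta) => //.
  by rewrite /delta le_max lexx orbT.
apply: bounded_sumsZ => //.
apply: (@bounded_sums_le _ _ (fun m => 2 ^+ m * psi (2 ^ m)%N ^+ k + q ^+ m)) => [m|].
  apply: (@le_trans _ _ ((2 ^ m)%:R * (psi (2 ^ m)%N ^+ k + ((2 ^ m)%:R `^ (- (1 + eta) / k%:R)) ^+ k))).
    apply: ler_wpM2l => //; apply: max_pow_le; last exact: powR_ge0.
    by have /andP[] := psi01 _ (p2 m).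
  rewrite mulrDr natrX lerD2l -natrX -powR_mulrn ?powR_ge0 // -powRrM.
  rewrite mulfVK ?gt_eqF // -[X in X * _]powRr1 ?ler0n // -powRD.
    by rewrite (_ : 1 + - (1 + eta) = - eta) ?powR_pow2 //; ring.
  by rewrite pnatr_eq0 -lt0n p2 implybT.
apply: bounded_sumsD; last by apply: bounded_sums_geometric => //; exact: ltW.
have psiX n : (0 < n)%N -> 0 <= psi n ^+ k.
  by move=> n0; rewrite exprn_ge0 //; have /andP[] := psi01 _ n0.
(* On [2^m, 2^(m+1)) condensation provides the lower bound psi(2^(m+1)), one index ahead. *)
apply: bounded_sums_shift => [m|]; first by apply: mulr_ge0; [exact: exprn_ge0|exact: psiX].
apply: (@bounded_sums_le _ _ (fun m => 2 * (2 ^+ m * psi (2 ^ m.+1)%N ^+ k))) => [m|].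
  by rewrite exprS mulrA.
apply: bounded_sumsZ => //.
apply: (condensation_bounded (fun n => psi n ^+ k)) => // m n /andP[h1 h2].
have n0 : (0 < n)%N by apply: leq_trans h1.
apply: lerXn2r; rewrite ?nnegrE.
- by have /andP[] := psi01 _ (p2 m.+1).
- by have /andP[] := psi01 _ n0.
- by apply: psi_dec => //; exact: ltnW.
Qed.

End Khinchin.

(** * Covering a hyperbolic region by dyadic boxes *)

Section HyperbolicCover.
Context {R : realType}.

(** Expanding the products, the empty monomial contributes N, and for a nonempty one the sum over i
    of a product of nonnegative terms is at most the product of the sums. The induction runs on the
    products minus 1. *)
Lemma sum_prod_1D_le (J : Type) (N : nat) (s : J -> 'I_N -> R) (r : seq J) :
  (forall j i, 0 <= s j i) ->
  \sum_(i < N) \prod_(j <- r) (1 + s j i) <= N%:R + \prod_(j <- r) (1 + \sum_(i < N) s j i).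
Proof.
move=> s0.
have P1 i : 1 <= \prod_(j <- r) (1 + s j i).
  by elim/big_ind: _ => //= [x y|j _]; [exact: mulr_ege1|rewrite lerDl].
suff H : \sum_(i < N) (\prod_(j <- r) (1 + s j i) - 1) <=
    \prod_(j <- r) (1 + \sum_(i < N) s j i) - 1.
  move: H; rewrite sumrB sumr_const card_ord; lra.
elim: r {P1} => [|j r IH].
  rewrite big_nil subrr big1 // => i _; by rewrite big_nil subrr.
set S := \sum_(i < N) s j i.
have S0 : 0 <= S by apply: sumr_ge0.
have sS i : s j i <= S by rewrite /S (bigD1 i) //= lerDl sumr_ge0.
apply: (@le_trans _ _ (\sum_(i < N) ((\prod_(j <- r) (1 + s j i) - 1) * (1 + S) + s j i))).
  apply: ler_sum => i _; rewrite big_cons; set p := \prod_(_ <- _) _.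
  have p1 : 1 <= p by rewrite /p; elim/big_ind: _ => //= [x y|l _]; [exact: mulr_ege1|rewrite lerDl].
  have := sS i; have := s0 j i; nra.
rewrite big_split /= -mulr_suml -/S big_cons -/S.
set A := \sum_(i < N) _ in IH *; set B := \prod_(_ <- _) _ in IH *.
have := ler_wpM2r (_ : 0 <= 1 + S) IH; move=> /(_ (addr_ge0 ler01 S0)); lra.
Qed.

(** The cap T makes the level finite also when z = 0. *)
Lemma dyadic_level (T : nat) (z : R) : z < 1 ->
  exists f, [/\ (f <= T)%N, z < (2 ^+ f)^-1 & f = T \/ (2 ^+ f.+1)^-1 <= z].
Proof.
move=> z1; elim: T => [|T [f [fT zf]]].
  by exists 0%N; split => //; [rewrite expr0 invr1|left].
case=> [fE|h]; last by exists f; split; [exact: leqW|exact: zf|right].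
have [h|h] := leP (2 ^+ f.+1)^-1 z; first by exists f; split; [exact: leqW|exact: zf|right].
by exists f.+1; split; [rewrite fE|exact: h|left; rewrite fE].
Qed.

(** Lowering exponents enlarges a dyadic box, so only boxes with exponent sum exactly T have to be
    counted. *)
Lemma exists_sub_sum (k : nat) (f : 'I_k -> nat) (T : nat) : (T <= \sum_j f j)%N ->
  exists e : 'I_k -> nat, (forall j, (e j <= f j)%N) /\ (\sum_j e j = T)%N.
Proof.
elim: T => [|T IH] fT; first by exists (fun=> 0%N); split => //; rewrite big1.
have [e [ef eT]] := IH (ltnW fT).
have [j ejf] : exists j, (e j < f j)%N.
  apply: contrapT => H; move: fT; rewrite -eT ltnNge => /negP; apply.
  apply: leq_sum => j _; rewrite leqNgt; apply/negP => ?; apply: H; by exists j.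
exists (fun i => (e i + (i == j))%N); split => [i|].
  by case: eqP => [->|_]; rewrite ?addn1 ?addn0.
by rewrite big_split /= eT -big_mkcond /= sum1_card card1 addn1.
Qed.

(** One capped level already makes the levels sum to at least T. Otherwise each z_j >= 2^(-(f_j +
    1)), so the product is at least 2^(-(\sum f_j + k)) and the hypothesis forces \sum f_j > T;
    hence the k in the exponent. *)
Lemma hyperbolic_cover (k T : nat) (z : 'I_k -> R) :
  (forall j, 0 <= z j < 1) -> (T = 0%N \/ \prod_j z j < (2 ^+ (T + k))^-1) ->
  exists e : {ffun 'I_k -> 'I_T.+1},
    (\sum_j e j == T)%N /\ (forall j, z j < (2 ^+ e j)^-1).
Proof.
move=> z01 hT.
have /choice[f Hf] j : exists f, [/\ (f <= T)%N, z j < (2 ^+ f)^-1 &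
    f = T \/ (2 ^+ f.+1)^-1 <= z j].
  by apply: dyadic_level; have /andP[] := z01 j.
have sT : (T <= \sum_j f j)%N.
  have [[j fj]|nf] := pselect (exists j, f j = T).
    by rewrite (bigD1 j) //= fj leq_addr.
  case: hT => [->//|hT].
  have zf : (2 ^+ (\sum_j f j + k))^-1 <= \prod_j z j.
    have -> : (2 ^+ (\sum_j f j + k))^-1 = \prod_(j < k) (2 ^+ (f j).+1)^-1 :> R.
      rewrite -exprVn (_ : (\sum_j f j + k = \sum_(j < k) (f j).+1)%N); last first.
        under [RHS]eq_bigr do rewrite -addn1.
        by rewrite big_split /= sum1_card card_ord.
      by rewrite -prodrXr; apply: eq_bigr => j _; rewrite exprVn.
    apply: ler_prod => j _; rewrite invr_ge0 exprn_ge0 //=.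
    by have [_ _ [fT|//]] := Hf j; case: nf; exists j.
  have := le_lt_trans zf hT; rewrite ltf_pV2 ?posrE ?exprn_gt0 // ltr_eXn2l ?ltr1n //.
  by rewrite ltn_add2r => /ltnW.
have [e [ef eT]] := exists_sub_sum _ _ _ sT.
have eTj j : (e j < T.+1)%N.
  by have [fT _ _] := Hf j; rewrite ltnS (leq_trans (ef j)).
exists [ffun j => inord (e j)]; split.
  by apply/eqP; rewrite -[RHS]eT; apply: eq_bigr => j _; rewrite ffunE inordK.
move=> j; rewrite ffunE inordK //; have [_ zf _] := Hf j.
apply: (lt_le_trans zf); rewrite lef_pV2 ?posrE ?exprn_gt0 //.
by rewrite ler_eXn2l ?ltr1n.
Qed.

(** The prescribed sum recovers the first exponent from the k - 1 others. *)
Lemma card_hyperbolic_cover (k T : nat) : (0 < k)%N ->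
  (#|[pred e : {ffun 'I_k -> 'I_T.+1} | (\sum_j e j == T)%N]| <= T.+1 ^ k.-1)%N.
Proof.
case: k => // k _ /=.
pose h (e : {ffun 'I_k.+1 -> 'I_T.+1}) : {ffun 'I_k -> 'I_T.+1} :=
  [ffun i => e (lift ord0 i)].
set A := [pred e | _].
have hA : {in A &, injective h}.
  move=> e1 e2; rewrite !inE => /eqP s1 /eqP s2 /ffunP h12.
  have l i : e1 (lift ord0 i) = e2 (lift ord0 i) by have := h12 i; rewrite !ffunE.
  apply/ffunP => i; case: (unliftP ord0 i) => [i' ->|->] //.
  apply: val_inj => /=; have := etrans s1 (esym s2); rewrite !big_ord_recl.
  under eq_bigr do rewrite l.
  by move/eqP; rewrite eqn_add2r => /eqP.
rewrite -(card_in_imset hA); apply: leq_trans (max_card _) _.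
by rewrite card_ffun !card_ord.
Qed.

(** T is the integer part of log_2 of 1/(2^k delta), or 0 if that is negative. The first bound
    limits T, the second makes the box volume 2^(-T) be O(delta), the third is the covering
    hypothesis. *)
Lemma exists_dyadic_exponent (k : nat) (delta : R) : 0 < delta <= 1 ->
  exists T, [/\ 2 ^+ T * delta <= 1, 1 <= 2 ^+ (T + k).+1 * delta &
    T = 0%N \/ 2 ^+ (T + k) * delta <= 1].
Proof.
move=> /andP[d0 d1].
pose w := (2 ^+ k * delta)^-1.
have kd0 : 0 < 2 ^+ k * delta by rewrite mulr_gt0 ?exprn_gt0.
have w0 : 0 < w by rewrite invr_gt0.
have /andP[w1 w2] := truncn_itv (ltW w0).
set n := Num.truncn w in w1 w2.
pose T := trunc_log 2 n.
have wT : w <= 2 ^+ T.+1.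
  apply: (le_trans (ltW w2)); rewrite -natrX ler_nat; exact: trunc_log_ltn.
have low : 1 <= 2 ^+ (T + k).+1 * delta.
  rewrite -addSn exprD -mulrA -ler_pdivrMr // mul1r; exact: wT.
(* If w < 1 then n = 0, and the default value [trunc_log 2 0 = 0] gives T = 0. *)
have [n0|n0] := posnP n.
  have T0 : T = 0%N by rewrite /T n0.
  exists T; split => //; [by rewrite T0 expr0 mul1r|by left].
have up : 2 ^+ (T + k) * delta <= 1.
  rewrite exprD -mulrA -ler_pdivlMr // mul1r; apply: le_trans w1.
  by rewrite -natrX ler_nat; exact: trunc_logP.
exists T; split => //; last by right.
apply: le_trans up; rewrite ler_pM2r // ler_eXn2l ?ltr1n //; exact: leq_addr.
Qed.

End HyperbolicCover.

(** * The Gallagher statement *)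

Lemma fourier_abs1E (R : realType) (nu : probability R R) :
  (fun xi : 'I_1 -> int => fourier_abs1 R nu (xi ord0)) =
  charfun_abs nu [set` `[0%R, 1%R]] (fun (_ : 'I_1) (x : R) => x).
Proof.
apply/funext => xi; rewrite /fourier_abs1 /charfun_abs.
have E : phase (fun (_ : 'I_1) (x : R) => x) xi = fun x : R => (xi ord0)%:~R * x.
  by apply/funext => x; rewrite /phase big_ord1.
by rewrite E.
Qed.

Section Gallagher.
Context {R : realType} {k : nat} (k0 : (0 < k)%N).
Context (mu : probability (k.-tuple R) R) (mus : 'I_k -> probability R R).
Context (mu_prod : is_product_measure R k mu mus).

Let X1 (_ : 'I_1) (x : R) := x.
Let F (j : 'I_k) := charfun_abs (mus j) [set` `[0%R, 1%R]] X1.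

Definition strip (n e : nat) (y : R) : set R :=
  near_set ([set` `[0%R, 1%R]] : set R) X1 n (fun=> y) (2 ^+ e)^-1.

Definition strip_box (n : nat) (e : 'I_k -> nat) (y : 'I_k -> R) : set (k.-tuple R) :=
  [set x | forall j, strip n (e j) (y j) (tnth x j)].

(** The kernel length for delta = 2^(-e) and one coordinate: M - 1 <= 2^e / 8 is the kernel
    condition, and 8 M >= 2^e turns 2/M into 16/2^e. *)
Let M (e : nat) := (2 ^ e %/ 8).+1.

Lemma measurable_strip n e y : measurable (strip n e y).
Proof. by apply: measurable_near => // j; exact: measurable_id. Qed.

Lemma measurable_strip_box n e y : measurable (strip_box n e y).
Proof.
rewrite (_ : strip_box n e y = \bigcap_(j : 'I_k)
    ((fun x : k.-tuple R => tnth x j) @^-1` strip n (e j) (y j))).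
  apply: fin_bigcap_measurable => // j _; rewrite -[X in measurable X]setTI.
  by apply: measurable_tnth => //; exact: measurable_strip.
by apply/seteqP; split => x /= h j; [move=> _; exact: h|exact: h].
Qed.

Lemma strip_measure_le j n e y :
  (mus j (strip n e y) <= (16 / 2 ^+ e * (1 + dilated_rest (F j) n (M e)))%:E)%E.
Proof.
have p0 : 0 < (2 ^+ e : R) by rewrite exprn_gt0.
have h : 1%:R * ((M e).-1)%:R * (2 ^+ e)^-1 <= 1 / 8 :> R.
  rewrite mul1r ler_pdivrMr // -natrX /M /=.
  have : ((2 ^ e %/ 8 * 8)%:R : R) <= (2 ^ e)%:R by rewrite ler_nat leq_trunc_div.
  by rewrite natrM; lra.
have iv : 0 <= (2 ^+ e)^-1 :> R by rewrite invr_ge0 ltW.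
have mX (i : 'I_1) : measurable_fun setT (X1 i) by exact: measurable_id.
apply: le_trans (near_measure_le (mus j) _ _ X1 mX n (M e) _ _ _ iv h) _ => //.
rewrite lee_fin; apply: ler_wpM2r.
  by apply: addr_ge0 => //; apply: dilated_rest_ge0 => xi; exact: charfun_abs_ge0.
rewrite expr1 ler_pdivlMr // mulrAC ler_pdivrMr ?ltr0n //.
have : ((2 ^ e)%:R : R) <= (8 * M e)%:R.
  by rewrite ler_nat /M; have := ltn_ceil (2 ^ e) (isT : 0 < 8)%N; lia.
by rewrite natrX natrM; lra.
Qed.

Lemma strip_box_measure_le n e y :
  (mu (strip_box n e y) <=
   (\prod_(j < k) (16 / 2 ^+ e j * (1 + dilated_rest (F j) n (M (e j)))))%:E)%E.
Proof.
have /= -> := mu_prod (fun j => strip n (e j) (y j)) (fun j => measurable_strip _ _ _).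
have -> : (\prod_(j < k) mus j (strip n (e j) (y j)) =
   \prod_(j < k) (fine (mus j (strip n (e j) (y j))))%:E)%E.
  by apply: eq_bigr => j _; rewrite fineK // fin_num_measure //; exact: measurable_strip.
rewrite prodEFin lee_fin; apply: ler_prod => j _; rewrite fine_ge0 //=.
rewrite -lee_fin fineK ?fin_num_measure //; last exact: measurable_strip.
exact: strip_measure_le.
Qed.

(** The product of the one-dimensional bounds (N 2^(e_j))^a is (N^k 2^T)^a, which depends on e only
    through its sum and is at most (N^(k + 1 + eta))^a = N. *)
Lemma strip_box_block (a C eta : R) (N T : nat) (e : 'I_k -> nat) (y : 'I_k -> R) :
  0 < a -> 1 <= C -> a * (k%:R + 1 + eta) = 1 ->
  (forall j N M, (0 < N)%N -> (0 < M)%N ->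
      \sum_(i < N) dilated_rest (F j) (N + i) M <= C * (N * M)%:R `^ a) ->
  (0 < N)%N -> (\sum_j e j = T)%N -> 2 ^+ T <= (N%:R : R) `^ (1 + eta) ->
  (\sum_(i < N) mu (strip_box (N + i) e y) <=
    (16 ^+ k * (1 + (2 * C) ^+ k) * (N%:R / 2 ^+ T))%:E)%E.
Proof.
move=> a0 C1 aE HC N0 eT TN.
have F0 j xi : 0 <= F j xi by exact: charfun_abs_ge0.
pose s j (i : 'I_N) := dilated_rest (F j) (N + i) (M (e j)).
have s0 j i : 0 <= s j i by exact: dilated_rest_ge0.
have NR : 1 <= (N%:R : R) by rewrite ler1n.
apply: (@le_trans _ _ (\sum_(i < N) (16 ^+ k / 2 ^+ T * \prod_(j < k) (1 + s j i))%:E)%E).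
  apply: lee_sum => i _; apply: le_trans (strip_box_measure_le _ _ _) _.
  rewrite lee_fin big_split /= le_eqVlt; apply/orP; left; apply/eqP; congr (_ * _).
  rewrite big_split /= prodr_const card_ord; congr (_ * _).
  rewrite -eT -exprVn -prodrXr; apply: eq_bigr => j _; by rewrite exprVn.
rewrite sumEFin lee_fin -mulr_sumr.
have c0 : 0 <= 16 ^+ k / 2 ^+ T :> R by rewrite divr_ge0 ?exprn_ge0.
suff H : \sum_(i < N) \prod_(j < k) (1 + s j i) <= (1 + (2 * C) ^+ k) * N%:R.
  apply: (le_trans (ler_wpM2l c0 H)).
  by rewrite le_eqVlt; apply/orP; left; apply/eqP; ring.
apply: (le_trans (sum_prod_1D_le _ _ s _ s0)); rewrite mulrDl mul1r lerD2l.
have xE (x : nat) : (N * 2 ^ x)%:R `^ a = N%:R `^ a * (2 `^ a) ^+ x :> R.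
  by rewrite natrM powRM ?ler0n // powR_pow2.
have x1 (x : nat) : 1 <= (N * 2 ^ x)%:R `^ a :> R.
  by rewrite -[leLHS](powRr0 (N * 2 ^ x)%:R) ler_powR ?(ltW a0) // ler1n muln_gt0 N0 expn_gt0.
(* Doubling C absorbs the summand 1, since C (N 2^(e_j))^a >= 1. *)
apply: (@le_trans _ _ (\prod_(j < k) (2 * C * (N * 2 ^ e j)%:R `^ a))).
  apply: ler_prod => j _; apply/andP; split; first by rewrite addr_ge0 // sumr_ge0.
  have h : \sum_(i < N) s j i <= C * (N * 2 ^ e j)%:R `^ a.
    apply: (le_trans (HC j N (M (e j)) N0 isT)); apply: ler_wpM2l; first by lra.
    apply: ge0_ler_powR; rewrite ?nnegrE ?ler0n ?(ltW a0) //.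
    rewrite ler_nat leq_mul2l; apply/orP; right; rewrite /M.
    by apply: ltn_Pdiv; rewrite // expn_gt0.
  have := x1 (e j); have := mulr_ege1 C1 (x1 (e j)); lra.
rewrite big_split /= prodr_const card_ord ler_pM2l ?exprn_gt0 //; last by lra.
under eq_bigr do rewrite xE.
rewrite big_split /= prodr_const card_ord prodrXr eT -powR_pow2.
have -> : N%:R `^ a ^+ k = (N%:R ^+ k) `^ a :> R.
  by rewrite -!powR_mulrn ?powR_ge0 ?ler0n // powRAC.
rewrite -powRM ?exprn_ge0 ?ler0n //.
apply: (@le_trans _ _ ((N%:R `^ (k%:R + 1 + eta)) `^ a)).
  apply: ge0_ler_powR; rewrite ?nnegrE ?(ltW a0) ?powR_ge0 ?mulr_ge0 ?exprn_ge0 //.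
  rewrite -addrA powRD; last by rewrite pnatr_eq0 -lt0n N0 implybT.
  by rewrite powR_mulrn ?ler0n // ler_pM2l ?exprn_gt0 ?natrX //; lra.
by rewrite -powRrM mulrC aE powRr1 ?ler0n.
Qed.

Lemma common_dilated_exponent (beta : R) : 0 < beta ->
  (forall j, ((1 - beta)%:E < dim_l1_1 R (mus j))%E) ->
  exists a C : R, [/\ 0 < a, a < beta, 1 <= C &
    forall j N M, (0 < N)%N -> (0 < M)%N ->
      \sum_(i < N) dilated_rest (F j) (N + i) M <= C * (N * M)%:R `^ a].
Proof.
move=> b0 dimj.
have /choice[a /choice[C H]] j : exists a C : R, [/\ 0 < a, a < beta, 1 <= C &
    forall N M, (0 < N)%N -> (0 < M)%N ->
      \sum_(i < N) dilated_rest (F j) (N + i) M <= C * (N * M)%:R `^ a].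
  apply: l1dim_dilated_rest => //; first by move=> xi; exact: charfun_abs_ge0.
  by have := dimj j; rewrite /dim_l1_1 fourier_abs1E.
(* The starting value [beta / 2] keeps the maximal exponent positive and below [beta]. *)
exists (\big[Num.max/beta / 2]_j a j), (\big[Num.max/1]_j C j); split.
- by apply: lt_le_trans (bigmax_ge_id _ _ _ _); lra.
- by apply/bigmax_ltP; split => [|j _]; [lra|have [] := H j].
- exact: bigmax_ge_id.
move=> j N L N0 L0; have [a0 _ C1 Hj] := H j.
apply: (le_trans (Hj N L N0 L0)); apply: ler_pM; rewrite ?powR_ge0 //; first by lra.
- exact: le_bigmax.
- by apply: ler_powR; [rewrite ler1n muln_gt0 N0|exact: le_bigmax].
Qed.

Definition cover_set (n T : nat) (y : 'I_k -> R) : set (k.-tuple R) :=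
  \big[setU/set0]_(e : {ffun 'I_k -> 'I_T.+1} | (\sum_j e j == T)%N)
    strip_box n (fun j => e j) y.

Lemma measurable_cover_set n T y : measurable (cover_set n T y).
Proof. by apply: bigsetU_measurable => e _; exact: measurable_strip_box. Qed.

Lemma sub_cover_set (n T : nat) (y : 'I_k -> R) (x : k.-tuple R) :
  cube01 R k x ->
  (T = 0%N \/ \prod_(j < k) distZ R (n%:R * tnth x j - y j) < (2 ^+ (T + k))^-1) ->
  cover_set n T y x.
Proof.
move=> x01 hT.
have [|e [eT ze]] := hyperbolic_cover k T (fun j => distZ R (n%:R * tnth x j - y j)) _ hT.
  by move=> j; rewrite distZ_ge0 distZ_lt1.
rewrite /cover_set -bigcup_pred; exists e => //= j; split.
  by rewrite /= in_itv /=; exact: x01.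
by move=> i /=; exact: ze.
Qed.

(** The number of boxes is at most (T + 1)^(k-1), and taking logarithms in the bound on 2^T gives T
    <= (1 + eta) m; this produces the factor (log n)^(k-1). *)
Lemma cover_set_block (a C eta : R) (m T : nat) (y : 'I_k -> R) :
  0 < a -> 1 <= C -> 0 < eta -> a * (k%:R + 1 + eta) = 1 ->
  (forall j N M, (0 < N)%N -> (0 < M)%N ->
      \sum_(i < N) dilated_rest (F j) (N + i) M <= C * (N * M)%:R `^ a) ->
  2 ^+ T <= ((2 ^ m)%:R : R) `^ (1 + eta) ->
  (\sum_(i < 2 ^ m) mu (cover_set (2 ^ m + i) T y) <=
    ((1 + eta) ^+ k.-1 * m.+1%:R ^+ k.-1 *
     (16 ^+ k * (1 + (2 * C) ^+ k) * ((2 ^ m)%:R / 2 ^+ T)))%:E)%E.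
Proof.
move=> a0 C1 eta0 aE HC TN.
have N0 : (0 < 2 ^ m)%N by rewrite expn_gt0.
set V : R := 16 ^+ k * _ * _.
have V0 : 0 <= V.
  by rewrite /V !mulr_ge0 ?invr_ge0 ?exprn_ge0 // addr_ge0 // exprn_ge0 //; lra.
apply: (@le_trans _ _ (\sum_(i < 2 ^ m)
   \sum_(e : {ffun 'I_k -> 'I_T.+1} | (\sum_j e j == T)%N)
    mu (strip_box (2 ^ m + i) (fun j => e j) y))%E).
  by apply: lee_sum => i _; apply: measure_bigsetU_le => e; exact: measurable_strip_box.
rewrite exchange_big /=.
apply: (@le_trans _ _ (\sum_(e : {ffun 'I_k -> 'I_T.+1} | (\sum_j e j == T)%N) V%:E)%E).
  apply: lee_sum => e /eqP eT; exact: (strip_box_block a C eta).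
rewrite sumEFin lee_fin sumr_const -[leLHS]mulr_natl; apply: ler_wpM2r => //.
apply: (@le_trans _ _ ((T.+1 ^ k.-1)%:R)).
  by rewrite ler_nat; exact: card_hyperbolic_cover.
rewrite natrX -exprMn; apply: lerXn2r; rewrite ?nnegrE ?mulr_ge0 ?ler0n //; first by lra.
have Tm : (T%:R : R) <= (1 + eta) * m%:R.
  have l2 : 0 < ln (2 : R) by rewrite ln_gt0 // ltr1n.
  rewrite -(ler_pM2r l2); move: TN; rewrite -ler_ln ?posrE ?exprn_gt0 ?powR_gt0 ?ltr0n //.
  by rewrite ln_powR natrX !lnXn // -[ln 2 *+ T]mulr_natl -[ln 2 *+ m]mulr_natl mulrA.
rewrite -!natr1 mulrDr mulr1; lra.
Qed.

End Gallagher.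

Lemma condensation_log (R : realType) (k : nat) (psi : nat -> R) :
  admissible R psi ->
  (\sum_(1 <= n <oo) (psi n * (ln (n%:R : R)) ^+ k.-1)%:E < +oo)%E ->
  bounded_sums (fun m => 2 ^+ m * psi (2 ^ m)%N * m.+1%:R ^+ k.-1).
Proof.
move=> [psi01 psi_dec] psi_sum.
have p2 m : (0 < 2 ^ m)%N by rewrite expn_gt0.
have psi0 n : (0 < n)%N -> 0 <= psi n by move=> n0; have /andP[] := psi01 n n0.
have l2 : 0 < ln (2 : R) by rewrite ln_gt0 // ltr1n.
(* A lower bound on the block [2^m, 2^(m+1)): psi is taken at the right end, the logarithm at the
   left end. *)
pose v m := psi (2 ^ m.+1)%N * (m%:R * ln 2) ^+ k.-1.
have v0 m : 0 <= v m.
  by apply: mulr_ge0; [exact: psi0|rewrite exprn_ge0 // mulr_ge0 // ltW].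
have bv : bounded_sums (fun m => 2 ^+ m * v m).
  apply: (condensation_bounded (fun n => psi n * ln (n%:R : R) ^+ k.-1)) => //.
    by move=> n n0; apply: mulr_ge0; [exact: psi0|rewrite exprn_ge0 // ln_ge0 // ler1n].
  move=> m n /andP[h1 h2]; have n0 : (0 < n)%N by apply: leq_trans h1.
  have h3 : m%:R * ln 2 <= ln (n%:R : R).
    rewrite mulr_natl -lnXn // ler_ln ?posrE ?exprn_gt0 ?ltr0n //.
    by rewrite -natrX ler_nat.
  have h4 : 0 <= m%:R * ln (2 : R) by rewrite mulr_ge0 // ltW.
  apply: ler_pM; rewrite ?exprn_ge0 ?psi0 //.
    by apply: psi_dec => //; exact: ltnW.
  by apply: lerXn2r; rewrite ?nnegrE // (le_trans h4).
have t0 m : 0 <= 2 ^+ m * psi (2 ^ m)%N * m.+1%:R ^+ k.-1.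
  by apply: mulr_ge0; [apply: mulr_ge0; [exact: exprn_ge0|exact: psi0]|exact: exprn_ge0].
(* Two shifts: one because psi is taken at 2^(m+1), one because the factor m of [v m] vanishes at m
   = 0. The constant 3 comes from m + 3 <= 3 (m + 1). *)
apply: bounded_sums_shift => //.
apply: bounded_sums_shift => //.
apply: (@bounded_sums_le _ _ (fun m => (2 * (3 / ln 2) ^+ k.-1) * (2 ^+ m.+1 * v m.+1))).
  move=> m; have -> : 2 * (3 / ln 2) ^+ k.-1 * (2 ^+ m.+1 * v m.+1) =
      2 ^+ m.+2 * psi (2 ^ m.+2)%N * ((3 / ln 2) ^+ k.-1 * (m.+1%:R * ln 2) ^+ k.-1).
    by rewrite /v [2 ^+ m.+2]exprS; ring.
  apply: ler_wpM2l; first by apply: mulr_ge0; [exact: exprn_ge0|exact: psi0].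
  rewrite -exprMn (_ : 3 / ln 2 * (m.+1%:R * ln 2) = 3 * m.+1%:R :> R); last by field; rewrite gt_eqF.
  by rewrite -natrM; apply: lerXn2r; rewrite ?nnegrE ?ler0n // ler_nat; lia.
apply: bounded_sumsZ; first by rewrite mulr_ge0 // exprn_ge0 // divr_ge0 // ltW.
by apply: (bounded_sums_unshift (fun m => 2 ^+ m * v m)) => // m; rewrite mulr_ge0 ?exprn_ge0.
Qed.

Lemma gallagher_of_dim (R : realType) (k : nat) (mu : probability (k.-tuple R) R)
    (mus : 'I_k -> probability R R) :
  (0 < k)%N -> is_product_measure R k mu mus ->
  (forall j, ((1 - 1 / (k.+1)%:R)%:E < dim_l1_1 R (mus j))%E) ->
  inhom_conv_Gallagher R k mu.
Proof.
move=> k0 mu_prod dimj psi adm psi_sum y.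
have [psi01 psi_dec] := adm.
have b0 : 0 < 1 / k.+1%:R :> R by rewrite divr_gt0.
have [a [C [a0 ab C1 HC]]] := common_dilated_exponent mus _ b0 dimj.
pose eta := 1 / a - (k%:R + 1).
have eta0 : 0 < eta.
  by rewrite subr_gt0 ltr_pdivlMr // natr1 mulrC -ltr_pdivlMr.
have aE : a * (k%:R + 1 + eta) = 1 by rewrite /eta; field; rewrite gt_eqF.
have p2 m : (0 < 2 ^ m)%N by rewrite expn_gt0.
(* The floor N^(-(1 + eta)) gives 2^T <= 1/delta <= N^(1 + eta), and adds only a multiple of the
   summable (m + 1)^(k-1) 2^(-eta m). *)
pose delta m := Num.max (psi (2 ^ m)%N) ((2 ^ m)%:R `^ (- (1 + eta))).
pose q : R := 2 `^ (- eta).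
have [q0 q1] := powR2N_lt1 eta eta0.
have psi0 n : (0 < n)%N -> 0 <= psi n by move=> n0; have /andP[] := psi01 n n0.
have d01 m : 0 < delta m <= 1.
  rewrite /delta lt_max powR_gt0 ?ltr0n // orbT /= ge_max.
  have /andP[_ /ltW ->] := psi01 _ (p2 m).
  rewrite -[leRHS](powRr0 (2 ^ m)%:R) ler_powR ?ler1n //; lra.
have /choice[T HT] m := exists_dyadic_exponent k (delta m) (d01 m).
have TN m : 2 ^+ T m <= ((2 ^ m)%:R : R) `^ (1 + eta).
  have [h _ _] := HT m; have /andP[d0 _] := d01 m.
  have dl : (2 ^ m)%:R `^ (- (1 + eta)) <= delta m by rewrite /delta le_max lexx orbT.
  rewrite powRN in dl.
  have P0 : 0 < ((2 ^ m)%:R : R) `^ (1 + eta) by rewrite powR_gt0 // ltr0n.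
  rewrite -[leRHS]mul1r -ler_pdivrMr //; apply: le_trans h.
  by rewrite ler_pM2l ?exprn_gt0.
(* The last factor converts the box volume: 2^(-T) <= 2^(k+1) delta. *)
pose K := (1 + eta) ^+ k.-1 * (16 ^+ k * (1 + (2 * C) ^+ k)) * 2 ^+ k.+1.
have A0 : 0 <= (1 + eta) ^+ k.-1 by rewrite exprn_ge0 // addr_ge0 // ltW.
have D0 : 0 <= 16 ^+ k * (1 + (2 * C) ^+ k).
  by rewrite mulr_ge0 ?exprn_ge0 // addr_ge0 // exprn_ge0 //; lra.
have K0 : 0 <= K.
  by apply: mulr_ge0; [exact: mulr_ge0|exact: exprn_ge0].
apply: (borel_cantelli_dyadic mu (cube01ho R k)
  (fun n => [set x | \prod_(j < k) distZ R (n%:R * tnth x j - tnth y j) < psi n])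
  (fun m i => cover_set (2 ^ m + i) (T m) (tnth y))
  (fun m => K * ((2 ^ m)%:R * delta m * m.+1%:R ^+ k.-1))).
- exact: measurable_cube01ho.
- by move=> n; exact: measurable_prod_distZ.
- by move=> m i; exact: measurable_cover_set.
- move=> m i im x [/cube01ho_sub Dx /= h]; apply: sub_cover_set => //.
  have [_ _ [T0|hT]] := HT m; [by left|right].
  have /andP[d0 _] := d01 m.
  apply: (lt_le_trans h); apply: (@le_trans _ _ (delta m)).
    by rewrite /delta le_max psi_dec // leq_addr.
  by rewrite -[leRHS]mul1r ler_pdivlMr ?exprn_gt0 // mulrC.
- move=> m; apply: le_trans
    (cover_set_block k0 mu mus mu_prod a C eta m (T m) (tnth y) a0 C1 eta0 aE HC (TN m)) _.
  have [_ h _] := HT m.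
  have hi : (2 ^+ T m)^-1 <= 2 ^+ k.+1 * delta m.
    by rewrite -[leLHS]mul1r ler_pdivrMr ?exprn_gt0 // mulrAC -exprD addSn addnC.
  rewrite lee_fin.
  set A := (1 + eta) ^+ k.-1; set B := m.+1%:R ^+ k.-1; set D := 16 ^+ k * _; set N := (2 ^ m)%:R.
  have -> : A * B * (D * (N / 2 ^+ T m)) = (A * B * D * N) * (2 ^+ T m)^-1 by ring.
  have -> : K * (N * delta m * B) = (A * B * D * N) * (2 ^+ k.+1 * delta m) by rewrite /K -/A -/D; ring.
  apply: ler_wpM2l => //.
  by apply: mulr_ge0 => //; apply: mulr_ge0 => //; apply: mulr_ge0 => //; exact: exprn_ge0.
apply: bounded_sumsZ => //.
apply: (@bounded_sums_le _ _ (fun m =>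
    2 ^+ m * psi (2 ^ m)%N * m.+1%:R ^+ k.-1 + m.+1%:R ^+ k.-1 * q ^+ m)) => [m|].
  rewrite [X in _ + X]mulrC -mulrDl; apply: ler_wpM2r; first exact: exprn_ge0.
  have E : (2 ^ m)%:R * (2 ^ m)%:R `^ (- (1 + eta)) = q ^+ m.
    rewrite -[X in X * _]powRr1 ?ler0n // -powRD.
      by rewrite (_ : 1 + - (1 + eta) = - eta) ?powR_pow2 //; ring.
    by rewrite pnatr_eq0 -lt0n p2 implybT.
  rewrite -E -[2 ^+ m]natrX -mulrDr; apply: ler_wpM2l => //.
  have := @max_pow_le R (psi (2 ^ m)%N) ((2 ^ m)%:R `^ (- (1 + eta))) 1 (psi0 _ (p2 m)) (powR_ge0 _ _).
  by rewrite !expr1.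
apply: bounded_sumsD; first exact: condensation_log.
exact: bounded_sums_poly_geometric.
Qed.

Theorem theorem1p8 (R : realType) (k : nat) (k_gt0 : (0 < k)%N) :
  (forall mu : probability (k.-tuple R) R,
     mu (cube01 R k) = 1%E ->
     ((k%:R - k%:R / (k.+1)%:R)%:E < dim_l1 R k mu)%E ->
     inhom_conv_Khinchin R k mu) /\
  (forall (mu : probability (k.-tuple R) R) (mus : 'I_k -> probability R R),
     mu (cube01 R k) = 1%E ->
     ((k%:R - k%:R / (k.+1)%:R)%:E < dim_l1 R k mu)%E ->
     (forall j, mus j [set` `[0%R, 1%R]] = 1%E) ->
     is_product_measure R k mu mus ->
     (forall j, ((1 - 1 / (k.+1)%:R)%:E < dim_l1_1 R (mus j))%E) ->
     inhom_conv_Gallagher R k mu).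
Proof.
split=> [mu _ dimk|mu mus _ _ _ mu_prod dimj]; first exact: khinchin_of_dim.
exact: gallagher_of_dim mu_prod dimj.
Qed.
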